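(* Let $\mu:\mathbb{R}^d\to(0,\infty)$ be continuously differentiable and integrable, $M\in\mathbb{R}^{d\times d}$ symmetric positive definite, $h,\delta>0$, $m_{\max}\in\mathbb{N}$, and let $p_{\mathrm{micro}}(\cdot\mid\tilde\ell)$, $\tilde\ell\in2^{\mathbb{N}}$, be probability mass functions on the positive integers. Let $\Psi:\mathbb{A}\to\mathbb{A}$, $\Psi(\theta,\rho,m,b,\boldsymbol{\ell},i)=(\Phi_{i,0}|_{\boldsymbol{\ell}}(\theta,\rho),m,b-i,\mathcal{S}^i\boldsymbol{\ell},-i)$, and let the extended target density with biased progressive sampling be $$p_{\mathrm{joint}}^{\mathrm{BP}}(\theta,\rho,m,b,\boldsymbol{\ell},i)\ \propto\ e^{-H(\theta,\rho)}\,p_{\mathrm{orbit}}(m,b,\boldsymbol{\ell}\mid\theta,\rho)\,p_{\mathrm{index}}^{\mathrm{BP}}(i\mid\theta,\rho,m,b,\boldsymbol{\ell}),$$ with all objects as defined in the context. Then $p_{\mathrm{joint}}^{\mathrm{BP}}$ is invariant under $\Psi$, i.e. $p_{\mathrm{joint}}^{\mathrm{BP}}\circ\Psi=p_{\mathrm{joint}}^{\mathrm{BP}}$.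
   Context: Notation: $\mathbb{N}=\{0,1,2,\dots\}$, $2^{\mathbb{N}}=\{2^n:n\in\mathbb{N}\}$, $a{:}b=\{a,\dots,b\}$. $H(\theta,\rho)=-\log\mu(\theta)+\frac12\rho^{\top}M^{-1}\rho$; $\mathcal{F}(\theta,\rho)=(\theta,-\rho)$. Leapfrog map with step size $s>0$: $\Phi_s(\theta,\rho)=(\theta',\rho')$ with $\theta'=\theta+M^{-1}\big(s\rho+\frac{s^2}{2}\nabla\log\mu(\theta)\big)$, $\rho'=\rho+\frac s2\big(\nabla\log\mu(\theta)+\nabla\log\mu(\theta')\big)$; $\Phi_s^n$ is its $n$-fold composition. $\mathrm{micro}(\theta,\rho)=\min\{\ell\in2^{\mathbb{N}}:H_\ell^+-H_\ell^-\le\delta\}$, where $H_\ell^{+}$ and $H_\ell^-$ are the maximum and minimum of $H(\Phi_{h/\ell}^j(\theta,\rho))$ over $0\le j\le\ell$; this minimum is assumed to exist for all $(\theta,\rho)$. Augmented space: $\mathbb{A}$ is the set of tuples $z=(\theta,\rho,m,b,\boldsymbol{\ell},i)$ with $\theta,\rho\in\mathbb{R}^d$, $m\in\mathbb{N}$, $b\in0{:}(2^m-1)$, and, with $a:=b-2^m+1$, $\boldsymbol{\ell}=(\ell_j)_{a\le j\le b-1}$ positive integers and $i\in a{:}b$. Densities on $\mathbb{A}$ are with respect to Lebesgue measure in $(\theta,\rho)$ times counting measure in $(m,b,\boldsymbol{\ell},i)$. Evolution: $\Phi_{0,0}|_{\boldsymbol{\ell}}=\mathrm{id}$; for $j>0$,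 $\Phi_{j,0}|_{\boldsymbol{\ell}}=\Phi_{h/\ell_{j-1}}^{\ell_{j-1}}\circ\cdots\circ\Phi_{h/\ell_0}^{\ell_0}$; for $j<0$, $\Phi_{j,0}|_{\boldsymbol{\ell}}=\mathcal{F}\circ\Phi_{h/\ell_j}^{\ell_j}\circ\cdots\circ\Phi_{h/\ell_{-1}}^{\ell_{-1}}\circ\mathcal{F}$. Write $(\theta_j,\rho_j)=\Phi_{j,0}|_{\boldsymbol{\ell}}(\theta,\rho)$. The tuple $(\theta,\rho,m,b,\boldsymbol{\ell})$ encodes the orbit $\mathcal{O}=((\theta_a,\rho_a),\dots,(\theta_b,\rho_b))$ of length $2^m$. Shift: $(\mathcal{S}^i\boldsymbol{\ell})_j=\ell_{j+i}$ for $a-i\le j\le b-i-1$. Put $p_j^+=p_{\mathrm{micro}}(\ell_j\mid\mathrm{micro}(\theta_j,\rho_j))$ and $p_j^-=p_{\mathrm{micro}}(\ell_j\mid\mathrm{micro}(\theta_{j+1},-\rho_{j+1}))$. U-turns: an orbit over $a{:}b$ satisfies the U-turn condition if $\min\big(\rho_a^{\top}M^{-1}(\theta_b-\theta_a),\rho_b^{\top}M^{-1}(\theta_b-\theta_a)\big)<0$. An orbit of length $2^k$ satisfies the sub-U-turn condition if, for some $0\le r\le k$, one of its $2^r$ consecutive blocks of length $2^{k-r}$ satisfies the U-turn condition. Orbit kernel: $p_{\mathrm{orbit}}(\cdot\mid\theta,\rho)$ is the probability mass function of the output $(m,b,\boldsymbol{\ell})$ of the following procedure. Set $(\theta_0,\rho_0)=(\theta,\rho)$,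 $a_0=b_0=0$; draw i.i.d. Bernoulli$(1/2)$ variables $B_1,\dots,B_{m_{\max}}$. For $k=0,\dots,m_{\max}-1$: with current orbit $\mathcal{O}_k$ over $a_k{:}b_k$ (length $2^k$), generate an extension orbit $\mathcal{O}_k^{\mathrm{ext}}$ over $a_k^{\mathrm{ext}}{:}b_k^{\mathrm{ext}}$, equal to $(b_k+1){:}(b_k+2^k)$ if $B_{k+1}=1$ and $(a_k-2^k){:}(a_k-1)$ if $B_{k+1}=0$, by successive steps: forward from index $j$ to $j+1$, sample $\ell_j\sim p_{\mathrm{micro}}(\cdot\mid\mathrm{micro}(\theta_j,\rho_j))$ and set $(\theta_{j+1},\rho_{j+1})=\Phi_{h/\ell_j}^{\ell_j}(\theta_j,\rho_j)$; backward from index $j+1$ to $j$, sample $\ell_j\sim p_{\mathrm{micro}}(\cdot\mid\mathrm{micro}(\theta_{j+1},-\rho_{j+1}))$ and set $(\theta_j,\rho_j)=\mathcal{F}\circ\Phi_{h/\ell_j}^{\ell_j}\circ\mathcal{F}(\theta_{j+1},\rho_{j+1})$. If $\mathcal{O}_k^{\mathrm{ext}}$ satisfies the sub-U-turn condition, stop and output $\mathcal{O}_k$ (so $m=k$). Otherwise let $\mathcal{O}_{k+1}$ be the orbit over the union of the two index ranges; if $\mathcal{O}_{k+1}$ satisfies the U-turn condition or $k+1=m_{\max}$, stop and output $\mathcal{O}_{k+1}$ (so $m=k+1$). Outputting an orbit means outputting $(m,b,\boldsymbol{\ell})$ with $b$ its rightmost index and $\boldsymbol{\ell}=(\ell_j)_{a\le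 j\le b-1}$. Weights: $w_0=e^{-H(\theta_0,\rho_0)}$; for $j>0$, $w_j=\frac{e^{-H(\theta_j,\rho_j)}}{e^{-H(\theta_{j-1},\rho_{j-1})}}\frac{p_{j-1}^-}{p_{j-1}^+}w_{j-1}$; for $j<0$, $w_j=\frac{e^{-H(\theta_j,\rho_j)}}{e^{-H(\theta_{j+1},\rho_{j+1})}}\frac{p_j^+}{p_j^-}w_{j+1}$. Biased progressive index kernel: given an orbit with rightmost index $b=\sum_{r=1}^m B_r2^{r-1}$, $B_r\in\{0,1\}$, let $\mathcal{O}_k$, $0\le k\le m$, be the sub-orbit over $a_k{:}b_k$ with $b_k=\sum_{r=1}^kB_r2^{r-1}$, $a_k=b_k-2^k+1$, and let $a_k^{\mathrm{ext}}{:}b_k^{\mathrm{ext}}=(a_{k+1}{:}b_{k+1})\setminus(a_k{:}b_k)$. Let $\mathcal{W}_k$, $\mathcal{W}_k^{\mathrm{ext}}$ be the corresponding families of weights, $\sum\mathcal{W}$ the sum of a family, and $\alpha(\mathcal{W}_k,\mathcal{W}_k^{\mathrm{ext}})=\min\big(1,\sum\mathcal{W}_k^{\mathrm{ext}}/\sum\mathcal{W}_k\big)$. Then $p_{\mathrm{index}}^{\mathrm{BP}}(j\mid\theta,\rho,\mathcal{O}_0)=\mathbf{1}\{j=0\}$ and $$p_{\mathrm{index}}^{\mathrm{BP}}(j\mid\theta,\rho,\mathcal{O}_{k+1})=\alpha(\mathcal{W}_k,\mathcal{W}_k^{\mathrm{ext}})\frac{w_j}{\sum\mathcal{W}_k^{\mathrm{ext}}}\mathbf{1}\{j\in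 a_k^{\mathrm{ext}}{:}b_k^{\mathrm{ext}}\}+\big(1-\alpha(\mathcal{W}_k,\mathcal{W}_k^{\mathrm{ext}})\big)p_{\mathrm{index}}^{\mathrm{BP}}(j\mid\theta,\rho,\mathcal{O}_k)\mathbf{1}\{j\in a_k{:}b_k\},$$ and $p_{\mathrm{index}}^{\mathrm{BP}}(\cdot\mid\theta,\rho,m,b,\boldsymbol{\ell})=p_{\mathrm{index}}^{\mathrm{BP}}(\cdot\mid\theta,\rho,\mathcal{O}_m)$. Conventions: $p_{\mathrm{joint}}^{\mathrm{BP}}=0$ wherever $p_{\mathrm{orbit}}=0$; $w_j/\sum\mathcal{W}_k^{\mathrm{ext}}$ is read as $0$ if $\sum\mathcal{W}_k^{\mathrm{ext}}=0$. *)

(* Defs.v *)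
From HB Require Import structures.
From mathcomp Require Import all_boot all_order all_algebra.
From mathcomp Require Import all_classical all_reals all_analysis.
From mathcomp Require Import zify.
Import numFieldNormedType.Exports.
Import Order.TTheory GRing.Theory Num.Theory.

Set Implicit Arguments.
Unset Strict Implicit.
Unset Printing Implicit Defensive.

Local Open Scope classical_set_scope.
Local Open Scope ring_scope.

Section RealVectors.
Context {R : realType}.

Definition grad d (f : 'cV[R]_d -> R) (x : 'cV[R]_d) : 'cV[R]_d :=
  \col_i 'D_(delta_mx i 0) f x.

Definition C1 d (f : 'cV[R]_d -> R) : Prop :=
  (forall x, differentiable f x) /\ continuous (grad f).

Definition sym_posdef d (M : 'M[R]_d) : Prop :=
  M^T = M /\ forall x : 'cV[R]_d, x != 0 -> 0 < (x^T *m M *m x) 0 0.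

(** The library has no Lebesgue measure on R^d.  It is built here on the
    iterated product ((unit * R) * ...) * R, with [coord_vec] the identification
    of that product with R^d. *)
Record coord_space d := CoordSpace {
  coord_disp : measure_display;
  coord_type : measurableType coord_disp;
  coord_measure : {measure set coord_type -> \bar R};
  coord_vec : coord_type -> 'cV[R]_d }.

Definition coord_space0 : coord_space 0 :=
  @CoordSpace 0 _ unit (@dirac _ unit tt R) (fun=> 0).

Definition coord_spaceS d (E : coord_space d) : coord_space d.+1 :=
  @CoordSpace d.+1 _ (coord_type E * measurableTypeR R)%type
    (coord_measure E \x @lebesgue_measure R)%E
    (fun x => col_mx (const_mx x.2 : 'cV[R]_1) (coord_vec x.1)).

Fixpoint lebesgue_space d : coord_space d :=
  if d is d'.+1 then coord_spaceS (lebesgue_space d') else coord_space0.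

Definition lebesgue_integrable d (f : 'cV[R]_d -> R) : Prop :=
  (coord_measure (lebesgue_space d)).-integrable setT
    (fun x => (f (coord_vec x))%:E).

End RealVectors.

(** Discrete distributions, represented by their mass functions. *)
Section Mass.
Context {R : realType}.

Definition mass (T : Type) := T -> \bar R.

Definition mass_ret (T : choiceType) (x : T) : mass T :=
  fun y => ((x == y)%:R)%:E.

Definition mass_bind (T : choiceType) (U : Type)
    (p : mass T) (f : T -> mass U) : mass U :=
  fun y => (\esum_(x in [set: T]) (p x * f x y))%E.

Definition fair_coin : mass bool := fun=> (2^-1)%:E.

Fixpoint fair_coins (n : nat) : mass (seq bool) :=
  if n is n'.+1 then
    mass_bind fair_coin (fun B =>
    mass_bind (fair_coins n') (fun Bs => mass_ret (B :: Bs)))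
  else mass_ret [::].

(** Mass functions on the positive integers are functions on [nat] that vanish
    at 0. *)
Definition is_pmf_pos (p : nat -> R) : Prop :=
  [/\ forall l, 0 <= p l, p 0%N = 0 &
      (\esum_(l in [set: nat]) (p l)%:E = 1)%E].

End Mass.

Arguments mass R T : clear implicits.

Definition left_index (m b : nat) : int := b%:Z - (2 ^ m)%:Z + 1.

(** A family [(l_j)] indexed by [a, a+1, ...] is stored as the list
    [l_a; l_(a+1); ...]; [family_of a s] reads such a list and [list_of a n f]
    lists the [n] values of [f] from [a] on.  [family_of a s j] is meaningful
    only for [a <= j < a + size s]. *)
Definition family_of (a : int) (s : seq nat) : int -> nat :=
  fun j => nth 0%N s `|j - a|%N.

Definition list_of (a : int) (n : nat) (f : int -> nat) : seq nat :=
  mkseq (fun k => f (a + k%:Z)) n.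

Definition shift (i : int) (l : int -> nat) : int -> nat := fun j => l (j + i).

Section Dynamics.
Context {R : realType} {d : nat}.
Context (mu : 'cV[R]_d -> R) (M : 'M[R]_d) (h delta : R).
Context (pmicro : nat -> nat -> R) (mmax : nat).

Definition phase := ('cV[R]_d * 'cV[R]_d)%type.

Definition inner_invM (x y : 'cV[R]_d) : R := (x^T *m invmx M *m y) 0 0.

Definition hamiltonian (z : phase) : R :=
  - ln (mu z.1) + 2^-1 * inner_invM z.2 z.2.

Definition flip (z : phase) : phase := (z.1, - z.2).

Definition grad_log : 'cV[R]_d -> 'cV[R]_d := grad (fun x => ln (mu x)).

Definition leapfrog (s : R) (z : phase) : phase :=
  let theta' := z.1 + invmx M *m (s *: z.2 + (s ^+ 2 / 2) *: grad_log z.1) in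
  (theta', z.2 + (s / 2) *: (grad_log z.1 + grad_log theta')).

Definition Hmax (l : nat) (z : phase) : R :=
  \big[Num.max/hamiltonian z]_(j < l.+1)
    hamiltonian (iter j (leapfrog (h / l%:R)) z).

Definition Hmin (l : nat) (z : phase) : R :=
  \big[Num.min/hamiltonian z]_(j < l.+1)
    hamiltonian (iter j (leapfrog (h / l%:R)) z).

Definition micro_ok (z : phase) (l : nat) : Prop := Hmax l z - Hmin l z <= delta.

Definition is_micro (z : phase) (l : nat) : Prop :=
  [/\ exists n, l = (2 ^ n)%N, micro_ok z l &
      forall n, micro_ok z (2 ^ n)%N -> (l <= 2 ^ n)%N].

Definition micro (z : phase) : nat := xget 1%N [set l | is_micro z l].

Definition micro_steps (l : nat) (z : phase) : phase :=
  iter l (leapfrog (h / l%:R)) z.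

Fixpoint evolve_fwd (l : int -> nat) (n : nat) (z : phase) : phase :=
  if n is n'.+1 then micro_steps (l n'%:Z) (evolve_fwd l n' z) else z.

Fixpoint evolve_bwd (l : int -> nat) (n : nat) (z : phase) : phase :=
  if n is n'.+1 then micro_steps (l (- n%:Z)) (evolve_bwd l n' z) else z.

(** [Negz n] is the integer [-(n+1)]. *)
Definition evolve (l : int -> nat) (j : int) (z : phase) : phase :=
  match j with
  | Posz n => evolve_fwd l n z
  | Negz n => flip (evolve_bwd l n.+1 (flip z))
  end.

Definition p_plus (l : int -> nat) (z : phase) (j : int) : R :=
  pmicro (micro (evolve l j z)) (l j).

Definition p_minus (l : int -> nat) (z : phase) (j : int) : R :=
  pmicro (micro (flip (evolve l (j + 1) z))) (l j).

(** An orbit is given by the list of its points in increasing index order. *)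
Definition uturn (s : seq phase) : bool :=
  let za := head 0 s in let zb := last 0 s in
  Num.min (inner_invM za.2 (zb.1 - za.1)) (inner_invM zb.2 (zb.1 - za.1)) < 0.

Definition sub_uturn (k : nat) (s : seq phase) : bool :=
  [exists r : 'I_k.+1, [exists q : 'I_(2 ^ r),
    uturn (take (2 ^ (k - r)) (drop (q * 2 ^ (k - r)) s))]].

Definition draw_micro (z : phase) : mass R nat := fun l => (pmicro (micro z) l)%:E.

(** [n] successive extension steps from the point [z]; each step returns the
    sampled micro step count and the new point.  The returned list is in the
    order of generation, hence by decreasing index in [extend_bwd]. *)
Fixpoint extend_fwd (n : nat) (z : phase) : mass R (seq (nat * phase)) :=
  if n is n'.+1 then
    mass_bind (draw_micro z) (fun l =>
    let z' := micro_steps l z in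
    mass_bind (extend_fwd n' z') (fun e => mass_ret ((l, z') :: e)))
  else mass_ret [::].

Fixpoint extend_bwd (n : nat) (z : phase) : mass R (seq (nat * phase)) :=
  if n is n'.+1 then
    mass_bind (draw_micro (flip z)) (fun l =>
    let z' := flip (micro_steps l (flip z)) in
    mass_bind (extend_bwd n' z') (fun e => mass_ret ((l, z') :: e)))
  else mass_ret [::].

(** Orbit over [a:b]: the index [b], the points [(theta_j, rho_j)] for
    [a <= j <= b], and the list of [l_j] for [a <= j <= b - 1]. *)
Record nuts_orbit := NutsOrbit {
  orbit_right : nat;
  orbit_points : seq phase;
  orbit_ells : seq nat }.

Definition extension (B : bool) (k : nat) (O : nuts_orbit) : mass R (seq (nat * phase)) :=
  if B then extend_fwd (2 ^ k) (last 0 (orbit_points O))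
  else extend_bwd (2 ^ k) (head 0 (orbit_points O)).

Definition extension_points (B : bool) (e : seq (nat * phase)) : seq phase :=
  map snd (if B then e else rev e).

Definition extend (B : bool) (k : nat) (O : nuts_orbit) (e : seq (nat * phase)) : nuts_orbit :=
  if B then
    NutsOrbit (orbit_right O + 2 ^ k) (orbit_points O ++ map snd e)
      (orbit_ells O ++ map fst e)
  else
    NutsOrbit (orbit_right O) (map snd (rev e) ++ orbit_points O)
      (map fst (rev e) ++ orbit_ells O).

Definition output (k : nat) (O : nuts_orbit) : mass R (nat * nat * seq nat) :=
  mass_ret (k, orbit_right O, orbit_ells O).

(** Doubling procedure from round [k] on, with [Bs = B_(k+1), ..., B_mmax]; thus
    [k + 1 = mmax] exactly when the tail of [Bs] is empty. *)
Fixpoint doubling (k : nat) (Bs : seq bool) (O : nuts_orbit) :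
    mass R (nat * nat * seq nat) :=
  if Bs is B :: Bs' then
    mass_bind (extension B k O) (fun e =>
    if sub_uturn k (extension_points B e) then output k O
    else
      let O' := extend B k O e in
      if uturn (orbit_points O') || nilp Bs' then output k.+1 O'
      else doubling k.+1 Bs' O')
  else output k O.

Definition orbit_law (z : phase) : mass R (nat * nat * seq nat) :=
  mass_bind (fair_coins mmax) (fun Bs => doubling 0 Bs (NutsOrbit 0 [:: z] [::])).

Definition p_orbit (m b : nat) (s : seq nat) (z : phase) : R :=
  fine (orbit_law z (m, b, s)).

Section Index.
Context (l : int -> nat) (z : phase).

Definition expH (j : int) : R := expR (- hamiltonian (evolve l j z)).

Fixpoint weight_fwd (n : nat) : R :=
  if n is n'.+1 then
    expH n%:Z / expH n'%:Z * (p_minus l z n'%:Z / p_plus l z n'%:Z) * weight_fwd n'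
  else expH 0.

Fixpoint weight_bwd (n : nat) : R :=
  if n is n'.+1 then
    expH (- n%:Z) / expH (- n'%:Z) * (p_plus l z (- n%:Z) / p_minus l z (- n%:Z))
      * weight_bwd n'
  else expH 0.

Definition weight (j : int) : R :=
  match j with Posz n => weight_fwd n | Negz n => weight_bwd n.+1 end.

Context (b : nat).

(** [bit r] is B_(r+1) in b = \sum_(r = 1)^m B_r 2^(r-1). *)
Definition bit (r : nat) : bool := odd (b %/ 2 ^ r).

Definition sub_right (k : nat) : nat := (\sum_(r < k) bit r * 2 ^ r)%N.

Definition sub_left (k : nat) : int := left_index k (sub_right k).

Definition in_sub (k : nat) (j : int) : bool :=
  (sub_left k <= j) && (j <= (sub_right k)%:Z).

Definition in_ext (k : nat) (j : int) : bool := in_sub k.+1 j && ~~ in_sub k j.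

Definition sumW (k : nat) : R := \sum_(r < 2 ^ k) weight (sub_left k + r%:Z).

Definition sumWext (k : nat) : R :=
  \sum_(r < 2 ^ k.+1 | in_ext k (sub_left k.+1 + r%:Z))
    weight (sub_left k.+1 + r%:Z).

Definition alpha (k : nat) : R := Num.min 1 (sumWext k / sumW k).

(** Division by 0 is 0, so [weight j / sumWext k] is 0 when [sumWext k = 0]. *)
Fixpoint p_index_BP (k : nat) (j : int) : R :=
  if k is k'.+1 then
    alpha k' * (weight j / sumWext k') * (in_ext k' j)%:R
    + (1 - alpha k') * p_index_BP k' j * (in_sub k' j)%:R
  else (j == 0)%:R.

End Index.

(** Tuples (theta, rho, m, b, l, i), with [l] stored as the list of its values
    from index [a = b - 2^m + 1] on. *)
Record aug := Aug {
  aug_pt : phase;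
  aug_m : nat;
  aug_b : nat;
  aug_ells : seq nat;
  aug_i : int;
  _ : (aug_b < 2 ^ aug_m)%N;
  _ : size aug_ells = (2 ^ aug_m - 1)%N;
  _ : all (fun l => 0 < l)%N aug_ells;
  _ : (left_index aug_m aug_b <= aug_i) && (aug_i <= aug_b%:Z) }.

Definition aug_family (x : aug) : int -> nat :=
  family_of (left_index (aug_m x) (aug_b x)) (aug_ells x).

(** [b - i] is nonnegative on [aug], so that the absolute value is harmless. *)
Definition Psi_b (x : aug) : nat := `|(aug_b x)%:Z - aug_i x|%N.

Definition Psi_ells (x : aug) : seq nat :=
  list_of (left_index (aug_m x) (aug_b x) - aug_i x) (2 ^ aug_m x - 1)
    (shift (aug_i x) (aug_family x)).

Lemma Psi_bE (x : aug) : (Psi_b x)%:Z = (aug_b x)%:Z - aug_i x.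
Proof.
by case: x => z m b s i hb hs hp hi; rewrite /Psi_b /=; move: hi; lia.
Qed.

Lemma Psi_b_lt (x : aug) : (Psi_b x < 2 ^ aug_m x)%N.
Proof.
rewrite -ltz_nat Psi_bE; case: x => z m b s i hb hs hp /= hi.
by move: hi; rewrite /left_index; lia.
Qed.

Lemma Psi_ells_size (x : aug) : size (Psi_ells x) = (2 ^ aug_m x - 1)%N.
Proof. by rewrite size_mkseq. Qed.

Lemma Psi_ells_pos (x : aug) : all (fun l => 0 < l)%N (Psi_ells x).
Proof.
apply/(all_nthP 0%N) => k; rewrite Psi_ells_size => hk.
rewrite nth_mkseq// /shift /aug_family /family_of.
case: x hk => z m b s i hb hs hp hi /= hk.
have -> : (left_index m b - i + k%:Z + i - left_index m b) = k%:Z by lia.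
by move/(all_nthP 0%N): hp; apply; rewrite hs.
Qed.

Lemma Psi_i_in (x : aug) :
  (left_index (aug_m x) (Psi_b x) <= - aug_i x) && (- aug_i x <= (Psi_b x)%:Z).
Proof.
rewrite /left_index Psi_bE; case: x => z m b s i /= hb hs hp hi.
by apply/andP; split; move: hb; lia.
Qed.

Definition Psi (x : aug) : aug :=
  @Aug (evolve (aug_family x) (aug_i x) (aug_pt x)) (aug_m x) (Psi_b x)
    (Psi_ells x) (- aug_i x)
    (Psi_b_lt x) (Psi_ells_size x) (Psi_ells_pos x) (Psi_i_in x).

(** The unnormalized extended target density. *)
Definition joint_BP (x : aug) : R :=
  expR (- hamiltonian (aug_pt x))
  * p_orbit (aug_m x) (aug_b x) (aug_ells x) (aug_pt x)
  * p_index_BP (aug_family x) (aug_pt x) (aug_b x) (aug_m x) (aug_i x).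

End Dynamics.

Arguments aug R d : clear implicits.

Definition proportional (R : realType) (T : Type) (p q : T -> R) : Prop :=
  exists2 c : R, 0 < c & forall x, p x = c * q x.

(* Main.v *)
Require Import Defs.
From mathcomp Require Import all_boot all_order all_algebra.
From mathcomp Require Import all_classical all_reals all_analysis.
From mathcomp Require Import zify ring.
Import numFieldNormedType.Exports.
Import Order.TTheory GRing.Theory Num.Theory.

(** Number the points of the orbit of length 2^m by positions 0, ..., 2^m - 1.
    The leapfrog map is reversible, so the orbit computed from any of its points
    is the same list [P], and [Psi] only moves the base position from [q] to
    [p]; the step counts, as a list, do not change.

    The sub-orbit O_k is the dyadic block of length 2^k containing the base
    position, and its extension is the sibling block.  Hence p_orbit is the
    product of the p_micro factors, times an indicator which says that no proper
    dyadic block has a U-turn, times a stopping probability, and the last two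
    depend on the orbit only.  So e^(-H) p_orbit = C A(q) with C independent of
    the base and A(q) = e^(-H_q) prod_(u < q) p_u^- prod_(u >= q) p_u^+.

    If A(q) <> 0, the weights based at [q] are a multiple of A, and the index
    kernel is invariant under scaling of the weights.  The claim is therefore the
    detailed balance of the index kernel with respect to A.  It is proved by
    induction on the level at which [p] and [q] fall into the same block: there
    the flow is A(q) A(p) min(1 / S, 1 / S'), with S and S' the sums of A over the
    two sibling blocks; above that level both kernels have the same factors. *)

Set Implicit Arguments.
Unset Strict Implicit.
Unset Printing Implicit Defensive.

Local Open Scope ring_scope.

(** * Mass functions *)

Section Sums.
Context {R : realType}.

(** [fine] sends both infinities to 0, so no finiteness is needed. *)
Lemma fine_EFinM (c : R) (X : \bar R) : fine (c%:E * X)%E = c * fine X.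
Proof.
case: X => [x| |] //=; rewrite mulr0.
  have [c0|c0|->] := ltrgtP c 0.
  - by rewrite lt0_muley// lte_fin.
  - by rewrite gt0_muley// lte_fin.
  - by rewrite mul0e.
have [c0|c0|->] := ltrgtP c 0.
- by rewrite lt0_muleNy// lte_fin.
- by rewrite gt0_muleNy// lte_fin.
- by rewrite mul0e.
Qed.

Lemma esum_single (T : choiceType) (f : T -> \bar R) (x : T) :
    (0 <= f x)%E -> (forall y, y != x -> f y = 0%E) ->
  (\esum_(y in [set: T]) f y = f x)%E.
Proof.
move=> fx0 f0; rewrite -(esum_set1 fx0) [RHS]esum_mkcond.
apply: eq_esum => y _; case: ifPn => //; rewrite notin_setE /= => /eqP yx.
by rewrite f0.
Qed.

Lemma ge0_esumZl (T : choiceType) (f : T -> \bar R) (c : R) :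
    0 <= c -> (forall x, 0 <= f x)%E ->
  (\esum_(x in [set: T]) (c%:E * f x) = c%:E * \esum_(x in [set: T]) f x)%E.
Proof.
move=> c0 f0; rewrite /esum -ereal_supZl//; last first.
  by apply/set0P; exists 0%E, set0 => //; rewrite ?fsbig_set0.
congr ereal_sup; rewrite image_comp; apply: eq_imagel => A [finA _] /=.
by rewrite ge0_mule_fsumr.
Qed.

(** Sequences without the prefix [w] contribute nothing, and [cat w] is a bijection onto the others.
    This serves to fix the first coins and to sum over the rest. *)
Lemma esum_prefix (T : choiceType) (w : seq T) (f : seq T -> \bar R) :
    (forall s, take (size w) s != w -> f s = 0%E) ->
  (\esum_(s in [set: seq T]) f s = \esum_(s in [set: seq T]) f (w ++ s))%E.
Proof.
move=> f0.
rewrite -(@reindex_esum R _ _ setT [set s | take (size w) s = w] (cat w) f).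
  rewrite [RHS]esum_mkcond; apply: eq_esum => s _; case: ifPn => //.
  by rewrite notin_setE /= => /eqP/f0.
split => [s _|s t _ _ /eqP|s /= <-] /=; first by rewrite take_size_cat.
  by rewrite eqseq_cat// eqxx => /eqP.
by exists (drop (size w) s) => //; rewrite cat_take_drop.
Qed.

Definition mass_ge0 (T : Type) (p : mass R T) := forall x, (0 <= p x)%E.

Lemma mass_ret_ge0 (T : choiceType) (x : T) : mass_ge0 (mass_ret x).
Proof. by move=> y; rewrite lee_fin. Qed.

Lemma mass_bind_ge0 (T : choiceType) (U : Type) (p : mass R T)
    (f : T -> mass R U) :
  mass_ge0 p -> (forall x, mass_ge0 (f x)) -> mass_ge0 (mass_bind p f).
Proof. by move=> p0 f0 y; apply: esum_ge0 => x _; rewrite mule_ge0 ?p0 ?f0. Qed.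

(** Uniqueness is asked only of draws where both factors are nonzero, so that the supports of [p]
    and of [f] can be used together. *)
Lemma mass_bind_single (T : choiceType) (U : Type) (p : mass R T)
    (f : T -> mass R U) (y : U) (x : T) :
    mass_ge0 p -> (forall x, mass_ge0 (f x)) ->
    (forall x', p x' != 0%E -> f x' y != 0%E -> x' = x) ->
  mass_bind p f y = (p x * f x y)%E.
Proof.
move=> p0 f0 h; apply: esum_single; first by rewrite mule_ge0 ?p0 ?f0.
move=> x'; have [->|px] := eqVneq (p x') 0%E; first by rewrite mul0e.
have [->|fx] := eqVneq (f x' y) 0%E; first by rewrite mule0.
by rewrite (h _ px fx) eqxx.
Qed.

Lemma mass_bind_eq0 (T : choiceType) (U : Type) (p : mass R T)
    (f : T -> mass R U) (y : U) :
    (forall x, p x != 0%E -> f x y = 0%E) -> mass_bind p f y = 0%E.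
Proof.
move=> h; apply: esum1 => x _.
by have [->|/h ->] := eqVneq (p x) 0%E; rewrite ?mul0e ?mule0.
Qed.

Lemma mass_bind_neq0 (T : choiceType) (U : Type) (p : mass R T)
    (f : T -> mass R U) (y : U) :
  mass_bind p f y != 0%E -> exists x, p x != 0%E /\ f x y != 0%E.
Proof.
apply: contra_neqP => h; apply: mass_bind_eq0 => x px.
by apply: contra_notP h => /eqP fx; exists x.
Qed.

Lemma mass_ret_neq0 (T : choiceType) (x y : T) :
  @mass_ret R T x y != 0%E -> x = y.
Proof. by rewrite /mass_ret; case: (x =P y) => // _ /eqP. Qed.

Lemma fair_coins_ge0 n : mass_ge0 (@fair_coins R n).
Proof.
elim: n => [|n IH]; first exact: mass_ret_ge0.
apply: mass_bind_ge0 => [?|B]; first by rewrite lee_fin invr_ge0.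
by apply: mass_bind_ge0 => // ?; apply: mass_ret_ge0.
Qed.

(** The mass depends on the length alone, so the coins forced by different base positions are
    equally likely. *)
Lemma fair_coinsE n Bs :
  fair_coins n Bs = (if size Bs == n then 2^-1 ^+ n else 0 : R)%:E.
Proof.
elim: n Bs => [|n IH] [|B Bs] //=.
- by apply: mass_bind_eq0 => B _; apply: mass_bind_eq0 => Bs _.
- rewrite (@mass_bind_single _ _ _ _ _ B).
  + rewrite (@mass_bind_single _ _ _ _ _ Bs).
    * rewrite IH /mass_ret eqxx mule1 eqSS /fair_coin -EFinM.
      by case: ifP => _; rewrite ?mulr0// exprS.
    * exact: fair_coins_ge0.
    * by move=> ?; apply: mass_ret_ge0.
    * by move=> Bs' _ /mass_ret_neq0 H; case: H.
  + by move=> ?; rewrite lee_fin invr_ge0.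
  + move=> B'; apply: mass_bind_ge0; first exact: fair_coins_ge0.
    by move=> ?; apply: mass_ret_ge0.
  + move=> B' _ H; have [? [_ /mass_ret_neq0 e]] := mass_bind_neq0 H.
    by case: e.
Qed.

End Sums.

(** * Detailed balance on dyadic blocks *)

Section DyadicIndex.
Context {R : realType}.
Implicit Types (W : nat -> R) (q p k c : nat).

Definition block_sum W k c : R := \sum_(t < 2 ^ k) W (c * 2 ^ k + t)%N.

Definition sibling c : nat := if odd c then c.-1 else c.+1.

Lemma sibling_half c c' :
  (c' %/ 2 = c %/ 2)%N -> c' <> c -> c' = sibling c.
Proof. by rewrite /sibling; case: ifP; lia. Qed.

Lemma siblingK : involutive sibling.
Proof.
by move=> c; rewrite /sibling; case: (ifP (odd c)) => hc; case: ifP; lia.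
Qed.

Lemma sibling_neq c : (sibling c == c) = false.
Proof. by rewrite /sibling; case: ifP; lia. Qed.

Lemma divn_expS n k : (n %/ 2 ^ k.+1 = n %/ 2 ^ k %/ 2)%N.
Proof. by rewrite -divnMA -expnSr. Qed.

(** The biased progressive kernel in positions: [q] is the base, [p] the target, and at each level
    the extension is the sibling of the block of [q]. *)
Fixpoint dyadic_index W q k p : R :=
  if k is k'.+1 then
    let c := (q %/ 2 ^ k')%N in
    let al := Num.min 1 (block_sum W k' (sibling c) / block_sum W k' c) in
    al * (W p / block_sum W k' (sibling c)) * (p %/ 2 ^ k' == sibling c)%N%:R
    + (1 - al) * dyadic_index W q k' p * (p %/ 2 ^ k' == c)%N%:R
  else (p == q)%:R.

(** The blocks that enter at levels below [m] lie within the first [2 ^ m] positions, the only ones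
    where the weights will be compared. *)
Lemma dyadic_index_eq W W' q k p m : (k <= m)%N ->
    (q < 2 ^ m)%N -> (p < 2 ^ m)%N ->
    (forall t, (t < 2 ^ m)%N -> W t = W' t) ->
  dyadic_index W q k p = dyadic_index W' q k p.
Proof.
move=> km qm pm WW'; elim: k km => [//|k IH] km /=.
have hb c : (c.+1 * 2 ^ k <= 2 ^ m)%N -> block_sum W k c = block_sum W' k c.
  move=> hc; apply: eq_bigr => t _; apply: WW'; apply: leq_trans hc.
  by rewrite mulSn addnC ltn_add2r.
have hm : (2 ^ m = 2 ^ (m - k.+1) * 2 * 2 ^ k)%N.
  by rewrite -mulnA -expnS -expnD subnK.
have hq : (q %/ 2 ^ k < 2 ^ (m - k.+1) * 2)%N.
  by rewrite ltn_divLR ?expn_gt0// -hm.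
have hs : (sibling (q %/ 2 ^ k) < 2 ^ (m - k.+1) * 2)%N.
  by rewrite /sibling; case: ifP; lia.
rewrite !hb ?IH ?(ltnW km)// ?WW'//; by rewrite hm leq_pmul2r ?expn_gt0.
Qed.

Lemma dyadic_indexZ W (a : R) q k p : a != 0 ->
  dyadic_index (fun t => a * W t) q k p = dyadic_index W q k p.
Proof.
move=> a0; elim: k => [//|k IH] /=; rewrite IH.
have hb c : block_sum (fun t => a * W t) k c = a * block_sum W k c.
  by rewrite /block_sum mulr_sumr.
have cancel x y : (a * x) / (a * y) = x / y by rewrite -mulf_div divff// mul1r.
by rewrite !hb !cancel.
Qed.

Lemma dyadic_balance W q k p : (forall t, 0 <= W t) ->
    (p %/ 2 ^ k = q %/ 2 ^ k)%N ->
  W q * dyadic_index W q k p = W p * dyadic_index W p k q.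
Proof.
move=> W0; elim: k => [|k IH] /=.
  by rewrite expn0 !divn1 => ->.
rewrite !divn_expS => hpq.
(* In the same half both kernels carry the same factor [1 - al]; in opposite halves only the
   extension term survives. *)
have [e|/eqP ne] := eqVneq (p %/ 2 ^ k)%N (q %/ 2 ^ k)%N.
  rewrite e (eq_sym _ (sibling _)) sibling_neq !mulr0 !add0r !mulr1.
  by rewrite ![W _ * (_ * _)]mulrCA IH.
have e := sibling_half hpq ne.
rewrite e siblingK !eqxx !mulr0 !addr0 !mulr1.
set cq := (q %/ 2 ^ k)%N.
have Wle r : W r <= block_sum W k (r %/ 2 ^ k).
  rewrite /block_sum (bigD1 (Ordinal (ltn_pmod r (expn_gt0 2 k))))//=.
  by rewrite -divn_eq lerDl sumr_ge0.
have := Wle q; have := Wle p; rewrite e -/cq.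
set S := block_sum W k cq; set S' := block_sum W k (sibling cq) => hp hq.
(* A zero weight makes both sides vanish; otherwise both block sums are positive and may be divided
   by. *)
have [->|Wq0] := eqVneq (W q) 0; first by rewrite !(mul0r, mulr0).
have [->|Wp0] := eqVneq (W p) 0; first by rewrite !(mul0r, mulr0).
have S0 : 0 < S by apply: lt_le_trans hq; rewrite lt_def Wq0 W0.
have S'0 : 0 < S' by apply: lt_le_trans hp; rewrite lt_def Wp0 W0.
case: (lerP S S') => SS'.
  have -> : Num.min 1 (S' / S) = 1 by apply/min_idPl; rewrite ler_pdivlMr// mul1r.
  have -> : Num.min 1 (S / S') = S / S'.
    by apply/min_idPr; rewrite ler_pdivrMr// mul1r.
  by field; rewrite ?gt_eqF.
have -> : Num.min 1 (S / S') = 1.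
  by apply/min_idPl; rewrite ler_pdivlMr// mul1r ltW.
have -> : Num.min 1 (S' / S) = S' / S.
  by apply/min_idPr; rewrite ler_pdivrMr// mul1r ltW.
by field; rewrite ?gt_eqF.
Qed.

End DyadicIndex.

(** * Reversibility and weights *)

Section Reversibility.
Context {R : realType} {d : nat}.
Context (mu : 'cV[R]_d -> R) (M : 'M[R]_d) (h : R).
Implicit Types (z : phase (R := R) (d := d)) (l : int -> nat) (j : int).

Lemma flipK : involutive (@flip R d).
Proof. by case=> x r; rewrite /flip /= opprK. Qed.

(** With r' the new momentum, s r' - (s^2/2) g(x') = s r + (s^2/2) g(x), so the reversed step
    returns to x. It then adds the same two gradients to -r', which gives -r. *)
Lemma leapfrog_flip (s : R) z :
  leapfrog mu M s (flip (leapfrog mu M s z)) = flip z.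
Proof.
case: z => x r; rewrite /leapfrog /flip /=.
set g := grad_log mu; set x' := x + _.
have xE : x' + invmx M *m (s *: - (r + (s / 2) *: (g x + g x'))
                           + (s ^+ 2 / 2) *: g x') = x.
  rewrite {1}/x' -addrA -mulmxDr -[RHS]addr0; congr (_ + _).
  rewrite (_ : _ + _ = 0) ?mulmx0//.
  rewrite scalerN !scalerDr !scalerA; apply/colP => i; rewrite !mxE.
  by field.
rewrite xE; congr (_, _).
by rewrite opprD -addrA -[RHS]addr0 [g x' + g x]addrC addNr.
Qed.

Lemma micro_steps_flip n z :
  micro_steps mu M h n (flip (micro_steps mu M h n z)) = flip z.
Proof.
(* Only the iteration counts are generalized; the step size [h / n] must stay fixed in the
   induction. *)
rewrite /micro_steps; move: {1 3}n => k.
by elim: k => [//|k IH]; rewrite iterSr iterS leapfrog_flip.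
Qed.

(** At negative indices the forward step cancels the outermost backward step by reversibility, so
    one recursion covers both signs. *)
Lemma evolve_step l j z :
  evolve mu M h l (j + 1) z = micro_steps mu M h (l j) (evolve mu M h l j z).
Proof.
case: j => [n|[|n]].
- by rewrite addrC -intS.
- by rewrite /= micro_steps_flip flipK.
- have -> : Negz n.+1 + 1 = Negz n by rewrite !NegzE; lia.
  by rewrite /= micro_steps_flip.
Qed.

Lemma evolve_step_back l j z :
  evolve mu M h l j z
  = flip (micro_steps mu M h (l j) (flip (evolve mu M h l (j + 1) z))).
Proof. by rewrite evolve_step micro_steps_flip flipK. Qed.

(** Both sides obey the one-step recursion in [j], forwards and backwards, and agree at 0. This is
    why every point generates the same orbit. *)
Lemma evolve_shift l i j z :
  evolve mu M h (Defs.shift i l) j (evolve mu M h l i z)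
  = evolve mu M h l (i + j) z.
Proof.
elim/int_rec: j => [|n IH|n IH]; first by rewrite addr0.
  by rewrite intS addrC evolve_step IH addrA evolve_step /Defs.shift [_ + i]addrC.
rewrite evolve_step_back (_ : _ + 1 = - n%:Z); last by lia.
rewrite IH [RHS]evolve_step_back.
rewrite (_ : i + - n.+1%:Z + 1 = i + - n%:Z); last by lia.
by rewrite /Defs.shift [_ + i]addrC.
Qed.

End Reversibility.

Section Weights.
Context {R : realType} {d : nat}.
Context (mu : 'cV[R]_d -> R) (M : 'M[R]_d) (h delta : R).
Context (pmicro : nat -> nat -> R) (l : int -> nat) (z : phase (R := R) (d := d)).
Context (N q : nat).

Let pp (t : nat) := p_plus mu M h delta pmicro l z (t%:Z - q%:Z).
Let pm (t : nat) := p_minus mu M h delta pmicro l z (t%:Z - q%:Z).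
Let E (t : nat) := expH mu M h l z (t%:Z - q%:Z).

(** The quantity A, with Boltzmann factors [E]; [N] counts the steps, one less than the points. *)
Definition path_weight (E pp pm : nat -> R) (t : nat) : R :=
  E t * (\prod_(0 <= u < t) pm u * \prod_(t <= u < N) pp u).

Let A := path_weight E pp pm.

(** The ratio of consecutive values is the one in the recursion of the weights, here
    cross-multiplied because factors may be zero. *)
Lemma path_weightS (E' pp' pm' : nat -> R) t : (t < N)%N ->
  path_weight E' pp' pm' t.+1 * (E' t * pp' t)
  = path_weight E' pp' pm' t * (E' t.+1 * pm' t).
Proof.
move=> tN; rewrite /path_weight big_nat_recr//= (big_ltn tN).
by ring.
Qed.

(** Both sides equal [E q] at [q] and obey the same ratio recursion away from it. Forwards it
    divides by [pp u] with [q <= u], backwards by [pm u] with [u < q]; these are factors of [A q],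
    hence nonzero. *)
Lemma weight_path_weight t : (q <= N)%N -> A q != 0 -> (t <= N)%N ->
  weight mu M h delta pmicro l z (t%:Z - q%:Z) = E q / A q * A t.
Proof.
move=> qN Aq0.
have E0 u : E u != 0 by rewrite gt_eqF// expR_gt0.
have /and3P[_ hm hp] : [&& E q != 0, \prod_(0 <= u < q) pm u != 0
    & \prod_(q <= u < N) pp u != 0] by rewrite -!negb_or -!mulf_eq0.
have pm0 u : (u < q)%N -> pm u != 0.
  move=> uq; apply: contraNN hm => /eqP e.
  by rewrite (big_cat_nat (leq0n u.+1) uq)/= big_nat_recr//= e mulr0 mul0r.
have pp0 u : (q <= u < N)%N -> pp u != 0.
  move=> /andP[qu uN]; apply: contraNN hp => /eqP e.
  by rewrite (big_cat_nat qu (ltnW uN))/= (big_ltn uN) e mul0r mulr0.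
have AS u := path_weightS E pp pm u.
have Eqq : weight_fwd mu M h delta pmicro l z 0 = E q.
  by rewrite /= /E subrr.
case: (leqP q t) => [/subnKC <-|tq _].
  move: (t - q)%N => n; elim: n => [_|n IH qnN].
    by rewrite addn0 subrr divfK.
  have e k : (q + k)%:Z - q%:Z = k%:Z by lia.
  have tN : (q + n < N)%N by lia.
  have := AS _ tN; rewrite -/A -addnS => AS'.
  have := IH (ltnW tN); rewrite !e /= => ->.
  have -> : p_minus mu M h delta pmicro l z n%:Z = pm (q + n) by rewrite /pm e.
  have -> : p_plus mu M h delta pmicro l z n%:Z = pp (q + n) by rewrite /pp e.
  have -> : expH mu M h l z n.+1%:Z = E (q + n.+1)%N by rewrite /E e.
  have -> : expH mu M h l z n%:Z = E (q + n)%N by rewrite /E e.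
  have hpp : pp (q + n) != 0 by apply: pp0; rewrite leq_addr.
  have -> : A (q + n.+1) = A (q + n) * (E (q + n.+1)%N * pm (q + n)%N)
      / (E (q + n)%N * pp (q + n)%N).
    by rewrite -AS' mulfK// mulf_neq0.
  by field; rewrite hpp Aq0 E0.
have -> : t = (q - (q - t))%N by lia.
have : (q - t <= q)%N by lia.
move: (q - t)%N => n {t tq}; elim: n => [_|n IH nq].
  by rewrite subn0 subrr divfK.
have e k : (k <= q)%N -> (q - k)%:Z - q%:Z = - k%:Z by lia.
have eW k : weight mu M h delta pmicro l z (- k%:Z)
    = weight_bwd mu M h delta pmicro l z k by case: k.
have tS : (q - n)%N = (q - n.+1).+1 by lia.
have tN : (q - n.+1 < N)%N by lia.
have := AS _ tN; rewrite -/A -tS => AS'.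
have := IH (ltnW nq); rewrite !e ?(ltnW nq)// !eW /= => ->.
have -> : p_minus mu M h delta pmicro l z (- n.+1%:Z) = pm (q - n.+1).
  by rewrite /pm e.
have -> : p_plus mu M h delta pmicro l z (- n.+1%:Z) = pp (q - n.+1).
  by rewrite /pp e.
have -> : expH mu M h l z (- n.+1%:Z) = E (q - n.+1)%N by rewrite /E e.
have -> : expH mu M h l z (- n%:Z) = E (q - n)%N by rewrite /E e// ltnW.
have hpm : pm (q - n.+1) != 0 by apply: pm0; lia.
have -> : A (q - n.+1) = A (q - n) * (E (q - n.+1)%N * pp (q - n.+1)%N)
    / (E (q - n)%N * pm (q - n.+1)%N).
  by rewrite AS' mulfK// mulf_neq0.
by field; rewrite hpm Aq0 E0.
Qed.

End Weights.

(** * The orbit law *)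

Lemma iota_rcons t n : iota t n.+1 = rcons (iota t n) (t + n)%N.
Proof. by rewrite -cats1 -(iotaD _ _ 1) addn1. Qed.

(** * Sub-U-turns of a concatenation *)

Section SubUTurn.
Context {R : realType} {d : nat} (M : 'M[R]_d).

(** Depth 0 is the whole list, and the blocks at depth [r + 1] are those at depth [r] of the halves,
    numbered first through [s1] and then through [s2]. *)
Lemma sub_uturn_cat k (s1 s2 : seq (phase (R := R) (d := d))) :
    size s1 = (2 ^ k)%N -> size s2 = (2 ^ k)%N ->
  sub_uturn M k.+1 (s1 ++ s2)
  = [|| uturn M (s1 ++ s2), sub_uturn M k s1 | sub_uturn M k s2].
Proof.
move=> sz1 sz2; apply/idP/idP.
  case/existsP => -[[|r] rk] /existsP[[j jr]] /=.
    move: jr; rewrite expn0 ltnS leqn0 => /eqP ->.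
    by rewrite mul0n drop0 subn0 take_oversize ?size_cat ?sz1 ?sz2 ?expnS ?mul2n
      ?addnn// => ->.
  rewrite subSS.
  have e : (2 ^ k = 2 ^ r * 2 ^ (k - r))%N by rewrite -expnD subnKC.
  case: (ltnP j (2 ^ r)%N) => jr2.
    have le : ((j * 2 ^ (k - r)) + 2 ^ (k - r) <= 2 ^ k)%N.
      by rewrite e -mulSnr leq_mul2r jr2 orbT.
    rewrite drop_cat sz1 ifT; last first.
      by apply: leq_trans le; rewrite -addn1 leq_add2l expn_gt0.
    rewrite take_cat size_drop sz1 => h.
    have {}h : uturn M (take (2 ^ (k - r)) (drop (j * 2 ^ (k - r)) s1)).
      move: h; case: ltnP => // le'.
      have -> : (2 ^ (k - r) - (2 ^ k - j * 2 ^ (k - r)) = 0)%N.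
        by apply/eqP; rewrite subn_eq0 leq_subRL// (leq_trans (leq_addr _ _) le).
      by rewrite take0 cats0 take_oversize// size_drop sz1.
    apply/or3P; apply: Or32; apply/existsP; exists (Ordinal (rk : r < k.+1)%N).
    by apply/existsP; exists (Ordinal jr2).
  have jr' : (j - 2 ^ r < 2 ^ r)%N.
    by rewrite ltn_subLR// addnn -mul2n -expnS.
  rewrite drop_cat sz1 ifF; last first.
    by apply/negbTE; rewrite -leqNgt e leq_mul2r jr2 orbT.
  rewrite e -mulnBl => h.
  apply/or3P; apply: Or33; apply/existsP; exists (Ordinal (rk : r < k.+1)%N).
  by apply/existsP; exists (Ordinal jr').
case/or3P.
- move=> h; apply/existsP; exists ord0; apply/existsP => /=.
  exists (Ordinal (expn_gt0 2 0)) => /=.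
  by rewrite mul0n drop0 subn0 take_oversize// size_cat sz1 sz2 expnS mul2n addnn.
- case/existsP => -[r rk] /existsP[[j jr]] /= h.
  have e : (2 ^ k = 2 ^ r * 2 ^ (k - r))%N by rewrite -expnD subnKC.
  have le : ((j * 2 ^ (k - r)) + 2 ^ (k - r) <= 2 ^ k)%N.
    by rewrite e -mulSnr leq_mul2r jr orbT.
  apply/existsP; exists (Ordinal (rk : r.+1 < k.+2)%N) => /=.
  have jr' : (j < 2 ^ r.+1)%N by apply: leq_trans jr _; rewrite leq_exp2l.
  apply/existsP; exists (Ordinal jr') => /=; rewrite subSS.
  rewrite drop_cat sz1 ifT; last first.
    by apply: leq_trans le; rewrite -addn1 leq_add2l expn_gt0.
  rewrite takel_cat// size_drop sz1.
  by rewrite leq_subRL// (leq_trans (leq_addr _ _) le).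
- case/existsP => -[r rk] /existsP[[j jr]] /= h.
  have e : (2 ^ k = 2 ^ r * 2 ^ (k - r))%N by rewrite -expnD subnKC.
  apply/existsP; exists (Ordinal (rk : r.+1 < k.+2)%N) => /=.
  have jr' : (2 ^ r + j < 2 ^ r.+1)%N by rewrite expnS mul2n -addnn ltn_add2l.
  apply/existsP; exists (Ordinal jr') => /=; rewrite subSS.
  rewrite drop_cat sz1 ifF; last first.
    by apply/negbTE; rewrite -leqNgt e leq_mul2r leq_addr orbT.
  by rewrite mulnDl e addKn.
Qed.

Lemma uturn1 (z : phase (R := R) (d := d)) : uturn M [:: z] = false.
Proof.
by rewrite /uturn /= subrr /inner_invM !mulmx0 mxE minxx ltxx.
Qed.

End SubUTurn.

(** * Extensions along a given path *)

Section Extension.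
Context {R : realType} {d : nat}.
Context (mu : 'cV[R]_d -> R) (M : 'M[R]_d) (h delta : R).
Context (pmicro : nat -> nat -> R).
(** Nonnegativity is asked at values of [micro] only: these are powers of two, where [pmicro] is a
    mass function. *)
Context (draw_ge0 : forall z l, 0 <= pmicro (micro mu M h delta z) l).

Local Notation phase := (phase (R := R) (d := d)).
Local Notation steps := (micro_steps mu M h).
Local Notation draw := (draw_micro mu M h delta pmicro).
Local Notation extend_fwd := (extend_fwd mu M h delta pmicro).
Local Notation extend_bwd := (extend_bwd mu M h delta pmicro).
Local Notation extension := (extension mu M h delta pmicro).

Lemma draw_mass_ge0 z : mass_ge0 (draw z).
Proof. by move=> l; rewrite lee_fin draw_ge0. Qed.

Lemma extend_fwd_ge0 n z : mass_ge0 (extend_fwd n z).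
Proof.
elim: n z => [|n IH] z; first exact: mass_ret_ge0.
apply: mass_bind_ge0 => [|l]; first exact: draw_mass_ge0.
by apply: mass_bind_ge0 => // e; apply: mass_ret_ge0.
Qed.

Lemma extend_bwd_ge0 n z : mass_ge0 (extend_bwd n z).
Proof.
elim: n z => [|n IH] z; first exact: mass_ret_ge0.
apply: mass_bind_ge0 => [|l]; first exact: draw_mass_ge0.
by apply: mass_bind_ge0 => // e; apply: mass_ret_ge0.
Qed.

Lemma extension_ge0 B k O : mass_ge0 (extension B k O).
Proof. by case: B; [apply: extend_fwd_ge0|apply: extend_bwd_ge0]. Qed.

(** The head of the list records the draw, so only [u = x] contributes, and its second component has
    to be [f x]. *)
Lemma mass_bind_cons (U V : choiceType) (p : mass R U) (f : U -> V)
    (r : U -> mass R (seq (U * V))) x y (e : seq (U * V)) :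
    mass_ge0 p -> (forall u, mass_ge0 (r u)) ->
  mass_bind p (fun u => mass_bind (r u)
    (fun e => mass_ret ((u, f u) :: e))) ((x, y) :: e)
  = (if y == f x then p x * r x e else 0)%E.
Proof.
move=> p0 r0.
have b0 u : mass_ge0 (mass_bind (r u) (fun e => mass_ret ((u, f u) :: e))).
  by apply: mass_bind_ge0 => // ?; apply: mass_ret_ge0.
rewrite (@mass_bind_single _ _ _ _ _ _ x)//; last first.
  by move=> u _ H; have [e' [_ /mass_ret_neq0[]]] := mass_bind_neq0 H.
case: eqP => [->|ne]; last first.
  rewrite mass_bind_eq0 ?mule0// => e' _; apply/eqP.
  by apply: contra_notT ne => /mass_ret_neq0[].
rewrite (@mass_bind_single _ _ _ _ _ _ e)//.
  by rewrite /mass_ret eqxx mule1.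
  by move=> ?; apply: mass_ret_ge0.
by move=> e' _ /mass_ret_neq0[].
Qed.

Lemma mass_bind_nil (U V : choiceType) (p : mass R U) (f : U -> V)
    (r : U -> mass R (seq (U * V))) :
  mass_bind p (fun u => mass_bind (r u)
    (fun e => mass_ret ((u, f u) :: e))) [::] = 0%E.
Proof. by apply: mass_bind_eq0 => u _; apply: mass_bind_eq0. Qed.

Lemma extend_fwd_cons n z l y e : extend_fwd n.+1 z ((l, y) :: e)
  = (if y == steps l z then draw z l * extend_fwd n y e else 0)%E.
Proof.
rewrite /= (mass_bind_cons (fun l => steps l z)).
- by case: eqP => // ->.
- exact: draw_mass_ge0.
- by move=> u; apply: extend_fwd_ge0.
Qed.

Lemma extend_bwd_cons n z l y e : extend_bwd n.+1 z ((l, y) :: e)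
  = (if y == flip (steps l (flip z))
     then draw (flip z) l * extend_bwd n y e else 0)%E.
Proof.
rewrite /= (mass_bind_cons (fun l => flip (steps l (flip z)))).
- by case: eqP => // ->.
- exact: draw_mass_ge0.
- by move=> u; apply: extend_bwd_ge0.
Qed.

Lemma extension_size B k O e : extension B k O e != 0%E -> size e = (2 ^ k)%N.
Proof.
rewrite /extension; case: B.
  move: (last 0 _) (2 ^ k)%N => z n; elim: n z e => [|n IH] z [|[l y] e].
  - by [].
  - by move=> /mass_ret_neq0.
  - by rewrite /= mass_bind_nil eqxx.
  - rewrite extend_fwd_cons; case: (y =P _) => _; last by rewrite eqxx.
    by rewrite mule_eq0 negb_or => /andP[_ /IH /= ->].
move: (head 0 _) (2 ^ k)%N => z n; elim: n z e => [|n IH] z [|[l y] e].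
- by [].
- by move=> /mass_ret_neq0.
- by rewrite /= mass_bind_nil eqxx.
- rewrite extend_bwd_cons; case: (y =P _) => _; last by rewrite eqxx.
  by rewrite mule_eq0 negb_or => /andP[_ /IH /= ->].
Qed.

Section Path.
Context (P : nat -> phase) (L : nat -> nat).
Context (P_step : forall t, P t.+1 = steps (L t) (P t)).

Lemma P_step_back t : P t = flip (steps (L t) (flip (P t.+1))).
Proof. by rewrite P_step micro_steps_flip flipK. Qed.

Definition path_plus t := pmicro (micro mu M h delta (P t)) (L t).
Definition path_minus t := pmicro (micro mu M h delta (flip (P t.+1))) (L t).

(** Each new point is a function of the previous one and of the step count, so the counts determine
    an outcome of nonzero mass. *)
Lemma extend_fwd_path n t e : extend_fwd n (P t) e != 0%E ->
    map fst e = map L (iota t n) ->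
  e = map (fun u => (L u, P u.+1)) (iota t n).
Proof.
elim: n t e => [|n IH] t [|[l y] e] //=.
rewrite -/(Defs.extend_fwd _ _ _ _ _ n.+1 _) extend_fwd_cons => + [le me].
rewrite le -P_step; case: (y =P _) => [->|_]; last by rewrite eqxx.
by rewrite mule_eq0 negb_or => /andP[_ /IH /(_ me) ->].
Qed.

(** The entry generated first has the highest index, so the induction removes the last element of
    [iota]; reversibility identifies the backward steps with the path. *)
Lemma extend_bwd_path n t e : extend_bwd n (P (t + n)) e != 0%E ->
    map fst (rev e) = map L (iota t n) ->
  rev e = map (fun u => (L u, P u)) (iota t n).
Proof.
elim: n e => [|n IH] [|[l y] e].
- by [].
- by move=> /mass_ret_neq0.
- by move=> _ /(congr1 size).
rewrite iota_rcons extend_bwd_cons rev_cons !map_rcons => + /rcons_inj[me le].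
rewrite /= in le; rewrite le addnS -P_step_back.
case: (y =P _) => [->|_]; last by rewrite eqxx.
by rewrite mule_eq0 negb_or => /andP[_ /IH /(_ me) ->].
Qed.

Lemma extend_fwd_pathE n t :
  extend_fwd n (P t) (map (fun u => (L u, P u.+1)) (iota t n))
  = (\prod_(t <= u < t + n) path_plus u)%:E.
Proof.
elim: n t => [|n IH] t; first by rewrite addn0 big_geq// /= /mass_ret eqxx.
rewrite [iota _ _]/= [map _ _]/= extend_fwd_cons -P_step eqxx IH addnS.
by rewrite [in RHS]big_ltn ?EFinM ?addSn// ltnS leq_addr.
Qed.

Lemma extend_bwd_pathE n t :
  extend_bwd n (P (t + n)) (rev (map (fun u => (L u, P u)) (iota t n)))
  = (\prod_(t <= u < t + n) path_minus u)%:E.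
Proof.
elim: n => [|n IH]; first by rewrite addn0 big_geq// /= /mass_ret eqxx.
rewrite iota_rcons map_rcons rev_rcons addnS extend_bwd_cons -P_step_back eqxx IH.
by rewrite [in RHS]big_nat_recr ?leq_addr//= mulrC EFinM.
Qed.

End Path.
End Extension.

(** * The doubling procedure *)

Section Doubling.
Context {R : realType} {d : nat}.
Context (mu : 'cV[R]_d -> R) (M : 'M[R]_d) (h delta : R).
Context (pmicro : nat -> nat -> R).
Context (draw_ge0 : forall z l, 0 <= pmicro (micro mu M h delta z) l).

Local Notation phase := (phase (R := R) (d := d)).
Local Notation steps := (micro_steps mu M h).
Local Notation extension := (extension mu M h delta pmicro).
Local Notation doubling := (doubling mu M h delta pmicro).
Local Notation uturn := (uturn M).
Local Notation sub_uturn := (sub_uturn M).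

Lemma doubling_ge0 k Bs O : mass_ge0 (doubling k Bs O).
Proof.
elim: Bs k O => [|B Bs IH] k O; first exact: mass_ret_ge0.
apply: mass_bind_ge0 => [|e]; first exact: extension_ge0.
case: ifP => _ /=; first exact: mass_ret_ge0.
by case: ifP => _; [apply: mass_ret_ge0|apply: IH].
Qed.

(** Extensions only add step counts at the two ends, and from round [k] on each has a length
    divisible by [2 ^ k]. The divisibility will determine the coins. *)
Lemma doubling_support k Bs O m b s : doubling k Bs O (m, b, s) != 0%E ->
  exists u v, [/\ s = u ++ orbit_ells O ++ v, (orbit_right O + size v = b)%N
    & (2 ^ k %| size v)%N].
Proof.
have out k' (O' : nuts_orbit (R := R) (d := d)) :
    output k' O' (m, b, s) != 0%E ->
    exists u v, [/\ s = u ++ orbit_ells O' ++ v, (orbit_right O' + size v = b)%N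
      & (2 ^ k' %| size v)%N].
  move=> /mass_ret_neq0[_ <- <-]; exists [::], [::].
  by rewrite cats0 addn0 dvdn0.
elim: Bs k O => [|B Bs IH] k O; first exact: out.
move=> H; have [e [/(extension_size draw_ge0) sz]] := mass_bind_neq0 H => {H}.
case: ifP => _ /=; first exact: out.
have ext : (exists u v, [/\ s = u ++ orbit_ells (extend B k O e) ++ v,
      (orbit_right (extend B k O e) + size v = b)%N & (2 ^ k.+1 %| size v)%N]) ->
    exists u v, [/\ s = u ++ orbit_ells O ++ v, (orbit_right O + size v = b)%N
      & (2 ^ k %| size v)%N].
  case: B => -[u [v [-> /= <- dv]]].
    exists u, (map fst e ++ v); rewrite size_cat size_map sz !catA addnA.
    by split => //; rewrite dvdn_addr// (dvdn_trans _ dv)// expnS dvdn_mull.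
  exists (u ++ map fst (rev e)), v; rewrite !catA; split => //.
  by rewrite (dvdn_trans _ dv)// expnS dvdn_mull.
by case: ifP => _ hs; apply: ext; [apply: out|apply: IH].
Qed.

(** An accepted extension lengthens the list of counts, so this outcome can only come from stopping
    at once, and that decision does not involve the right index. *)
Lemma doubling_output m Bs b b' (pts : seq phase) s :
  doubling m Bs (NutsOrbit b pts s) (m, b, s)
  = doubling m Bs (NutsOrbit b' pts s) (m, b', s).
Proof.
have outE (a : nat) : mass_ret (m, a, s) (m, a, s) = (1%:E : \bar R).
  by rewrite /mass_ret eqxx.
case: Bs => [|B Bs]; first by rewrite /= /output /= !outE.
have sub_neq (a : nat) e :
    extension B m (NutsOrbit b pts s) e != 0%E ->
    (let O' := extend B m (NutsOrbit a pts s) e in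
     (if uturn (orbit_points O') || nilp Bs then output m.+1 O'
      else doubling m.+1 Bs O') (m, a, s)) = 0%E.
  move=> /(extension_size draw_ge0) sz; apply/eqP/contraT => /= H.
  have [] : exists u v, [/\ s = u ++ orbit_ells (extend B m (NutsOrbit a pts s) e)
        ++ v, (orbit_right (extend B m (NutsOrbit a pts s) e) + size v = a)%N
      & (2 ^ m.+1 %| size v)%N].
    move: H; case: ifP => _ H.
      exact: (@doubling_support _ [::] _ _ _ _ H).
    exact: doubling_support H.
  move=> u [v [/(congr1 size) + _ _]].
  have := expn_gt0 2 m.
  by case: B {H} sz => /= sz; rewrite !size_cat !size_map ?size_rev sz; lia.
rewrite /=; apply: eq_esum => e _.
have [e0|ne0] := eqVneq (extension B m (NutsOrbit b pts s) e) 0%E.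
  have e0' : extension B m (NutsOrbit b' pts s) e = 0%E := e0.
  by rewrite e0 e0' !mul0e.
congr (_ * _)%E; case: ifP => _; first by rewrite /output /= !outE.
exact: etrans (sub_neq b e ne0) (esym (sub_neq b' e ne0)).
Qed.

(** * Dyadic blocks of a fixed path *)

Section Blocks.
Context (P : nat -> phase) (L : nat -> nat) (m : nat).
Context (P_step : forall t, P t.+1 = steps (L t) (P t)).

Definition path_block k c := map P (iota (c * 2 ^ k) (2 ^ k)).

(** Indices are relative to the base [q], so the right index is the last position of the block minus
    [q]. *)
Definition block_orbit q k := let c := (q %/ 2 ^ k)%N in
  NutsOrbit (c.+1 * 2 ^ k - 1 - q) (path_block k c)
    (map L (iota (c * 2 ^ k) (2 ^ k - 1))).

(** The extension that reproduces the sibling block; as in [extend_bwd], a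
    backward extension is listed by decreasing index. *)
Definition block_ext q k := let c := (q %/ 2 ^ k)%N in
  if odd c then rev (map (fun u => (L u, P u)) (iota (c.-1 * 2 ^ k) (2 ^ k)))
  else map (fun u => (L u, P u.+1)) (iota (c.+1 * 2 ^ k - 1) (2 ^ k)).

Local Notation pp := (path_plus mu M h delta pmicro P L).
Local Notation pm := (path_minus mu M h delta pmicro P L).

(** Step [u] joins positions [u] and [u.+1], so the forward range starts at the last position of the
    block, [c.+1 * 2 ^ k - 1]. *)
Definition block_ext_prod q k := let c := (q %/ 2 ^ k)%N in
  if odd c then \prod_(c.-1 * 2 ^ k <= u < c.-1 * 2 ^ k + 2 ^ k) pm u
  else \prod_(c.+1 * 2 ^ k - 1 <= u < c.+1 * 2 ^ k - 1 + 2 ^ k) pp u.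

Definition block_prod q k := let c := (q %/ 2 ^ k)%N in
  \prod_(c * 2 ^ k <= u < q) pm u * \prod_(q <= u < c.+1 * 2 ^ k - 1) pp u.

Lemma ltn_block q k : (q %/ 2 ^ k * 2 ^ k <= q < (q %/ 2 ^ k).+1 * 2 ^ k)%N.
Proof. by rewrite leq_divM ltn_ceil ?expn_gt0. Qed.

Lemma path_block_head k c : head 0 (path_block k c) = P (c * 2 ^ k).
Proof. by rewrite /path_block; have := expn_gt0 2 k; case: (2 ^ k)%N. Qed.

Lemma path_block_last k c : last 0 (path_block k c) = P (c.+1 * 2 ^ k - 1).
Proof.
rewrite /path_block; have := expn_gt0 2 k; case: (2 ^ k)%N => // n _.
rewrite (last_nth 0) size_map size_iota.
rewrite -[nth _ _ _]/(nth 0 (map P (iota (c * n.+1) n.+1)) n).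
by rewrite (nth_map 0%N) ?size_iota// nth_iota//; congr P; lia.
Qed.

Lemma path_block0 c : path_block 0 c = [:: P c].
Proof. by rewrite /path_block expn0 muln1. Qed.

Lemma path_blockS k c :
  path_block k.+1 c = path_block k (2 * c) ++ path_block k (2 * c).+1.
Proof.
rewrite /path_block -map_cat; congr map.
rewrite (_ : 2 ^ k.+1 = 2 ^ k + 2 ^ k)%N ?iotaD ?expnS; last by lia.
by congr (iota _ _ ++ iota _ _); lia.
Qed.

Lemma size_path_block k c : size (path_block k c) = (2 ^ k)%N.
Proof. by rewrite size_map size_iota. Qed.

(** A block of even index is the left half of its parent and grows forwards; one of odd index grows
    backwards. *)
Lemma block_extend q k :
  extend (~~ odd (q %/ 2 ^ k)) k (block_orbit q k) (block_ext q k)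
  = block_orbit q k.+1.
Proof.
have := ltn_block q k; have K0 := expn_gt0 2 k.
rewrite /block_orbit /block_ext /extend divn_expS /path_block.
set c := (q %/ 2 ^ k)%N => hq; set K := (2 ^ k)%N in K0 hq *.
have e2 : (2 ^ k.+1 = K + K)%N by rewrite expnS mul2n addnn.
have hd : (c = (c %/ 2) * 2 + odd c)%N by lia.
rewrite e2; case: (odd c) hd => /= hd.
  rewrite revK -!map_comp; set c' := (c %/ 2)%N in hd *.
  congr NutsOrbit; first by rewrite hd; lia.
    by rewrite -map_cat iotaD hd; congr (map _ (iota _ _ ++ iota _ _)); lia.
  rewrite -map_cat (_ : K + K - 1 = K + (K - 1))%N ?iotaD; last by lia.
  by congr (map _ (iota _ _ ++ iota _ _)); rewrite hd; lia.
set c' := (c %/ 2)%N in hd *.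
have -> : map snd [seq (L u, P u.+1) | u <- iota (c.+1 * K - 1) K]
    = map P (iota (c.+1 * K) K).
  have -> : (c.+1 * K = 1 + (c.+1 * K - 1))%N by lia.
  by rewrite iotaDl -!map_comp addKn.
rewrite -[map fst _]map_comp.
congr NutsOrbit; first by rewrite hd; lia.
  by rewrite -map_cat iotaD hd; congr (map _ (iota _ _ ++ iota _ _)); lia.
rewrite -map_cat (_ : K + K - 1 = (K - 1) + K)%N ?iotaD; last by lia.
by congr (map _ (iota _ _ ++ iota _ _)); rewrite hd; lia.
Qed.

Lemma block_extension_points q k :
  extension_points (~~ odd (q %/ 2 ^ k)) (block_ext q k)
  = path_block k (sibling (q %/ 2 ^ k)).
Proof.
rewrite /extension_points /block_ext /sibling /path_block.
set c := (q %/ 2 ^ k)%N; have K0 := expn_gt0 2 k.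
case: (odd c) => /=; first by rewrite revK -map_comp.
have -> : (c.+1 * 2 ^ k = 1 + (c.+1 * 2 ^ k - 1))%N by lia.
by rewrite iotaDl -!map_comp addKn.
Qed.

Lemma block_extensionE q k :
  extension (~~ odd (q %/ 2 ^ k)) k (block_orbit q k) (block_ext q k)
  = (block_ext_prod q k)%:E.
Proof.
rewrite /extension /block_ext /block_ext_prod /block_orbit /=.
rewrite path_block_head path_block_last.
set c := (q %/ 2 ^ k)%N; case oc: (odd c) => /=; last exact: extend_fwd_pathE.
have -> : (c * 2 ^ k = c.-1 * 2 ^ k + 2 ^ k)%N.
  by rewrite -mulSnr prednK//; case: (c) oc.
exact: extend_bwd_pathE.
Qed.

Lemma block_prodS q k :
  block_prod q k * block_ext_prod q k = block_prod q k.+1.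
Proof.
have := ltn_block q k; have K0 := expn_gt0 2 k.
rewrite /block_prod /block_ext_prod divn_expS.
set c := (q %/ 2 ^ k)%N => hq; set K := (2 ^ k)%N in K0 hq *.
have -> : (2 ^ k.+1 = K + K)%N by rewrite expnS mul2n addnn.
have hd : (c = (c %/ 2) * 2 + odd c)%N by lia.
set c' := (c %/ 2)%N in hd *; case: (odd c) hd => /= hd.
  rewrite mulrAC [X in X * _ = _]mulrC.
  rewrite [in RHS](@big_cat_nat _ _ _ (c * K))/=; [|by rewrite hd; lia|lia].
  by congr (_ * _ * _); congr bigop; congr index_iota; rewrite hd; lia.
rewrite -mulrA -big_cat_nat/=; [|lia|lia].
by congr (_ * _); congr bigop; congr index_iota; rewrite hd; lia.
Qed.

Lemma map_iota_infix (f : nat -> nat) a n u y v :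
  map f (iota a n) = u ++ y ++ v -> y = map f (iota (a + size u) (size y)).
Proof.
move=> e; have sz : n = (size u + (size y + size v))%N.
  by have := congr1 size e; rewrite size_map size_iota !size_cat.
move: e; rewrite sz !iotaD !map_cat => /eqP.
rewrite eqseq_cat ?size_map ?size_iota// => /andP[_].
by rewrite eqseq_cat ?size_map ?size_iota// => /andP[/eqP-> _].
Qed.

(** The parity of the block index is forced because the indices that remain to
    the right must be filled by blocks of length at least 2^(k+1). *)
Lemma block_ext_unique q k B e u v : (k < m)%N -> (q < 2 ^ m)%N ->
    extension B k (block_orbit q k) e != 0%E ->
    map L (iota 0 (2 ^ m - 1))
      = u ++ orbit_ells (extend B k (block_orbit q k) e) ++ v ->
    (orbit_right (extend B k (block_orbit q k) e) + size v = 2 ^ m - 1 - q)%N ->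
    (2 ^ k.+1 %| size v)%N ->
  B = ~~ odd (q %/ 2 ^ k) /\ e = block_ext q k.
Proof.
move=> km qm e0; have sz := extension_size draw_ge0 e0.
have := ltn_block q k; have K0 := expn_gt0 2 k.
move: e0; rewrite /extension /block_orbit /block_ext.
rewrite path_block_head path_block_last.
set c := (q %/ 2 ^ k)%N => e0 hq.
have hm : (2 ^ m = 2 ^ (m - k.+1) * 2 * 2 ^ k)%N.
  by rewrite -mulnA -expnS -expnD subnK.
case: B e0 => /= e0.
  rewrite -catA catA => /[dup] hs /map_iota_infix hfst.
  have := congr1 size hs.
  rewrite !size_cat !size_map !size_iota sz => szs szv /dvdnP[w hw].
  rewrite hw expnS hm in szs szv.
  (* In blocks of length [2 ^ k], the [c + 2] up to the new right end and the [2 * w] still missing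
     on the right make [2 ^ (m - k)], which is even. *)
  have oc : ~~ odd c.
    have : (c + 2 + 2 * w = 2 ^ (m - k.+1) * 2)%N; last by lia.
    apply/eqP; rewrite -(eqn_pmul2r K0) -hm; apply/eqP.
    by rewrite hm; lia.
  rewrite oc; split => //; rewrite (negbTE oc).
  apply: (extend_fwd_path draw_ge0 P_step e0).
  rewrite hfst size_cat !size_map size_iota sz; congr (map _ (iota _ _)).
  by lia.
move=> /[dup] hs; rewrite -catA => /map_iota_infix hfst.
have := congr1 size hs.
rewrite !size_cat !size_map !size_iota size_rev sz => szs szv /dvdnP[w hw].
rewrite hw expnS hm in szs szv.
(* A backward extension keeps the right end, so only [c + 1] blocks lie up to it. *)
have oc : odd c.
  have : (c + 1 + 2 * w = 2 ^ (m - k.+1) * 2)%N; last by lia.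
  apply/eqP; rewrite -(eqn_pmul2r K0) -hm; apply/eqP.
  by rewrite hm; lia.
rewrite oc; split => //.
have ce : (c * 2 ^ k = c.-1 * 2 ^ k + 2 ^ k)%N.
  by rewrite -mulSnr prednK//; case: (c) oc.
rewrite ce in e0.
rewrite -(extend_bwd_path draw_ge0 P_step e0) ?revK//.
rewrite hfst size_map size_rev sz; congr (map _ (iota _ _)).
by lia.
Qed.

(** The mass of the target output once round [k] has produced the block of [q]
    and its U-turn test is still to be done. *)
Definition block_output q k Bs : \bar R :=
  (if uturn (path_block k (q %/ 2 ^ k)) || nilp Bs then output k (block_orbit q k)
   else doubling k Bs (block_orbit q k))
    (m, 2 ^ m - 1 - q, map L (iota 0 (2 ^ m - 1)))%N.

(** Stopping with [k < m] gives the wrong first component, so the target needs an accepted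
    extension, and [block_ext_unique] leaves one coin and one extension. *)
Lemma doubling_block q k B Bs : (k < m)%N -> (q < 2 ^ m)%N ->
  doubling k (B :: Bs) (block_orbit q k)
    (m, 2 ^ m - 1 - q, map L (iota 0 (2 ^ m - 1)))%N
  = if (B == ~~ odd (q %/ 2 ^ k))
       && ~~ sub_uturn k (path_block k (sibling (q %/ 2 ^ k)))
    then ((block_ext_prod q k)%:E * block_output q k.+1 Bs)%E else 0%E.
Proof.
move=> km qm.
have out0 (O : nuts_orbit (R := R) (d := d)) b s : output k O (m, b, s) = 0%E.
  rewrite /output /mass_ret; case: (_ =P _) => // -[km'].
  by rewrite km' ltnn in km.
pose F e : mass R _ := if sub_uturn k (extension_points B e)
  then output k (block_orbit q k)
  else let O' := extend B k (block_orbit q k) e in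
    if uturn (orbit_points O') || nilp Bs then output k.+1 O'
    else doubling k.+1 Bs O'.
have F0 e : mass_ge0 (F e).
  rewrite /F; case: ifP => _ /=; first exact: mass_ret_ge0.
  by case: ifP => _; [apply: mass_ret_ge0|apply: doubling_ge0].
have Funique e : extension B k (block_orbit q k) e != 0%E ->
    F e (m, 2 ^ m - 1 - q, map L (iota 0 (2 ^ m - 1)))%N != 0%E ->
    B = ~~ odd (q %/ 2 ^ k) /\ e = block_ext q k.
  move=> e0; rewrite /F; case: ifP => _; first by rewrite out0 eqxx.
  move=> H; suff [u [v [h1 h2 h3]]] : exists u v,
    [/\ map L (iota 0 (2 ^ m - 1))
        = u ++ orbit_ells (extend B k (block_orbit q k) e) ++ v,
      (orbit_right (extend B k (block_orbit q k) e) + size v = 2 ^ m - 1 - q)%N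
      & (2 ^ k.+1 %| size v)%N].
    exact: block_ext_unique h1 h2 h3.
  move: H => /=; case: ifP => _ H; last exact: doubling_support H.
  exact: (@doubling_support _ [::] _ _ _ _ H).
have -> : doubling k (B :: Bs) (block_orbit q k)
  = mass_bind (extension B k (block_orbit q k)) F by [].
case: (B =P _) => [e|ne] /=; last first.
  rewrite mass_bind_eq0// => e e0; apply/eqP/contraT => Fe.
  by have [] := Funique e e0 Fe.
rewrite (@mass_bind_single _ _ _ _ _ _ (block_ext q k))//; last first.
- by move=> e' h1 h2; have [] := Funique e' h1 h2.
- exact: extension_ge0.
rewrite /F e block_extensionE block_extension_points block_extend.
case: ifP => _; first by rewrite out0 mule0.
by [].
Qed.

Definition block_bits q k := map (fun r => ~~ odd (q %/ 2 ^ r)%N) (iota 0 k).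

Definition no_uturn q k := all (fun r => ~~ uturn (path_block r (q %/ 2 ^ r))
  && ~~ sub_uturn r (path_block r (sibling (q %/ 2 ^ r)))) (iota 0 k).

Lemma block_output_doubling q k Bs : (k <= m)%N -> (q < 2 ^ m)%N ->
  block_output q 0 Bs
  = if (take k Bs == block_bits q k) && no_uturn q k
    then ((block_prod q k)%:E * block_output q k (drop k Bs))%E else 0%E.
Proof.
move=> + qm; elim: k => [_|k IH km].
  rewrite take0 drop0 /block_prod /= expn0 divn1 !muln1 subSS subn0.
  by rewrite !big_geq// mulr1 mul1e.
rewrite {}IH ?(ltnW km)// /block_bits /no_uturn iota_rcons add0n.
rewrite map_rcons all_rcons.
(* If the coins run out at level [k < m], the procedure stops too early and both sides vanish. *)
case E : (drop k Bs) => [|B Bs'].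
  have -> : block_output q k [::] = 0%E.
    rewrite /block_output orbT /output /mass_ret; case: (_ =P _) => // -[km'].
    by rewrite km' ltnn in km.
  rewrite mule0 if_same.
  have szB : (size Bs <= k)%N.
    by rewrite -subn_eq0 -size_drop E.
  rewrite ifF//; apply/negbTE/negP => /andP[/eqP/(congr1 size)].
  rewrite size_rcons size_map size_iota size_take.
  by rewrite ltnNge (leqW szB) /= => e _; rewrite e ltnn in szB.
have szB : (k < size Bs)%N by rewrite -subn_gt0 -size_drop E.
have -> : take k.+1 Bs = rcons (take k Bs) B.
  by rewrite (take_nth B)// -[k in nth _ _ k]addn0 -nth_drop E.
have -> : drop k.+1 Bs = Bs' by rewrite -addn1 addnC -drop_drop E /= drop0.
rewrite eqseq_rcons /block_output.
have -> : nilp (B :: Bs') = false by [].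
rewrite orbF -block_prodS EFinM.
case: (uturn _).
  have -> : output k (block_orbit q k)
      (m, 2 ^ m - 1 - q, map L (iota 0 (2 ^ m - 1)))%N = 0%E.
    rewrite /output /mass_ret; case: (_ =P _) => // -[km'].
    by rewrite km' ltnn in km.
  by rewrite mule0 if_same andbF.
rewrite doubling_block// -/(block_output q k.+1 Bs').
case: (take k Bs == _); case: (all _ _); rewrite ?andbF ?andbT//.
by case: ifP => _; rewrite ?mule0 ?muleA.
Qed.

(** The halves of a block at level [k.+1] are the block of [q] at level [k], treated by induction,
    and its sibling, whose test [no_uturn] records. *)
Lemma no_uturn_sub q k : no_uturn q k && ~~ uturn (path_block k (q %/ 2 ^ k))
  = ~~ sub_uturn k (path_block k (q %/ 2 ^ k)).
Proof.
elim: k => [|k IH].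
  rewrite path_block0 uturn1; apply/esym/existsPn => r; apply/existsPn => j.
  case: r j => -[|//] r0 [[|//] j0] /=.
  by rewrite ?mul0n ?drop0 uturn1.
rewrite /no_uturn iota_rcons add0n all_rcons -/(no_uturn q k).
rewrite [_ && no_uturn q k]andbC andbA IH.
rewrite path_blockS sub_uturn_cat ?size_path_block// -path_blockS.
rewrite divn_expS; set c := (q %/ 2 ^ k)%N.
rewrite !negb_or andbC; congr (_ && _).
have hd : (c = 2 * (c %/ 2) + odd c)%N by lia.
set c' := (c %/ 2)%N in hd *; rewrite /sibling; case: (odd c) hd => /= ->.
  by rewrite addn1 andbC.
by rewrite addn0.
Qed.

(** By [no_uturn_sub] the condition says that neither half of the whole orbit has a sub-U-turn; the
    base only decides the order of the two tests. *)
Lemma no_uturn_base q q' k : (q < 2 ^ k)%N -> (q' < 2 ^ k)%N ->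
  no_uturn q k = no_uturn q' k.
Proof.
case: k => [_ _|k qk q'k]; first by [].
suff E r : (r < 2 ^ k.+1)%N -> no_uturn r k.+1
    = ~~ sub_uturn k (path_block k 0) && ~~ sub_uturn k (path_block k 1).
  by rewrite !E.
move=> rk; rewrite /no_uturn iota_rcons add0n all_rcons -/(no_uturn r k).
rewrite andbC andbA no_uturn_sub.
have : (r %/ 2 ^ k < 2)%N by rewrite ltn_divLR ?expn_gt0// -expnS.
by case: (r %/ 2 ^ k)%N => [|[|c]] lt2; [reflexivity|exact: andbC|].
Qed.

Lemma p_orbit_path mmax : exists C : R, forall q, (q < 2 ^ m)%N ->
  p_orbit mu M h delta pmicro mmax m (2 ^ m - 1 - q)
    (map L (iota 0 (2 ^ m - 1))) (P q)
  = C * (\prod_(0 <= u < q) pm u * \prod_(q <= u < 2 ^ m - 1) pp u).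
Proof.
have K0 := expn_gt0 2 m.
(* An indicator times a stopping probability, with base 0 as reference; [nseq m true] stands for the
   [m] forced coins, of which only the number matters. *)
exists ((no_uturn 0 m)%:R * fine (\esum_(t in [set: seq bool])
  (fair_coins mmax (nseq m true ++ t) * block_output 0 m t))%E).
move=> q qm.
have qm0 : (q %/ 2 ^ m = 0)%N by rewrite divn_small.
(* At level [m] the block is the whole orbit from every base; only the right index differs, which
   [doubling_output] handles. *)
have outE t : block_output q m t = block_output 0 m t.
  rewrite /block_output /block_orbit qm0 div0n mul1n subn0 mul0n.
  case: ifP => _; last exact: doubling_output.
  by rewrite /output /mass_ret !eqxx.
have -> : p_orbit mu M h delta pmicro mmax m (2 ^ m - 1 - q)
    (map L (iota 0 (2 ^ m - 1))) (P q)
  = fine (\esum_(Bs in [set: seq bool])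
      (fair_coins mmax Bs * block_output q 0 Bs))%E.
  congr fine; apply: eq_esum => Bs _; congr (_ * _)%E.
  rewrite /block_output /block_orbit expn0 divn1 !muln1 path_block0 uturn1 /=.
  rewrite subSS subn0 subnn.
  by case: Bs.
have szb : size (block_bits q m) = m by rewrite size_map size_iota.
rewrite (@esum_prefix _ _ (block_bits q m)); last first.
  move=> s; rewrite szb => /negbTE ne.
  by rewrite (block_output_doubling _ (leqnn m))// ne mule0.
rewrite (no_uturn_base (K0) qm).
have [nu|] := boolP (no_uturn q m); last first.
  move=> /negbTE nu; rewrite !mul0r esum1// => t _.
  by rewrite (block_output_doubling _ (leqnn m))// nu andbF mule0.
rewrite mul1r mulrC -fine_EFinM.
have -> : \prod_(0 <= u < q) pm u * \prod_(q <= u < 2 ^ m - 1) pp u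
    = block_prod q m.
  by rewrite /block_prod qm0 mul0n mul1n.
have prod_ge0 : 0 <= block_prod q m.
  by apply: mulr_ge0; apply: prodr_ge0 => *; apply: draw_ge0.
congr fine; rewrite -ge0_esumZl//; last first.
  move=> t; rewrite mule_ge0//; first exact: fair_coins_ge0.
  rewrite /block_output; case: ifP => _; first exact: mass_ret_ge0.
  exact: doubling_ge0.
apply: eq_esum => t _.
rewrite (block_output_doubling _ (leqnn m))// nu andbT.
rewrite take_size_cat// eqxx drop_size_cat// outE muleCA; congr (_ * (_ * _))%E.
by rewrite !fair_coinsE !size_cat szb size_nseq.
Qed.

End Blocks.
End Doubling.

(** * The index kernel in terms of positions *)

Section IndexKernel.
Context {R : realType} {d : nat}.
Context (mu : 'cV[R]_d -> R) (M : 'M[R]_d) (h delta : R).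
Context (pmicro : nat -> nat -> R) (l : int -> nat) (z : phase (R := R) (d := d)).
Context (m q : nat).
Context (qm : (q < 2 ^ m)%N).
Let b := (2 ^ m - 1 - q)%N.
Let W (t : nat) := weight mu M h delta pmicro l z (t%:Z - q%:Z).

Lemma sub_right_mod (a k : nat) : sub_right a k = (a %% 2 ^ k)%N.
Proof.
rewrite /sub_right; elim: k => [|k IH]; first by rewrite big_ord0 expn0 modn1.
have K0 := expn_gt0 2 k.
rewrite big_ord_recr /= IH /bit.
have ha := divn_eq a (2 ^ k); have hr := ltn_pmod a K0.
set c := (a %/ 2 ^ k)%N in ha *; set r := (a %% 2 ^ k)%N in ha hr *.
have hc : (c = c %/ 2 * 2 + odd c)%N by lia.
rewrite ha {2}hc mulnDl -addnA -mulnA -expnS modnMDl addnC modn_small// expnS.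
by case: (odd c); lia.
Qed.

(** Modulo [2 ^ k], as many points lie to the right of [q] in the orbit as in its block, since the
    blocks beyond are full. *)
Lemma sub_right_block k : (k <= m)%N ->
  sub_right b k = ((q %/ 2 ^ k).+1 * 2 ^ k - 1 - q)%N.
Proof.
move=> km; rewrite sub_right_mod /b.
have hq := ltn_block q k; have K0 := expn_gt0 2 k.
have hm : (2 ^ m = 2 ^ (m - k) * 2 ^ k)%N by rewrite -expnD subnK.
have hc : (q %/ 2 ^ k < 2 ^ (m - k))%N by rewrite ltn_divLR// -hm.
set c := (q %/ 2 ^ k)%N in hq hc *; rewrite hm.
have [w ->] : exists w, (2 ^ (m - k) = c.+1 + w)%N.
  by exists (2 ^ (m - k) - c.+1)%N; rewrite subnKC.
set K := (2 ^ k)%N in hq K0 *.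
have -> : ((c.+1 + w) * K - 1 - q = w * K + (c.+1 * K - 1 - q))%N.
  by rewrite mulnDl addnC -!subnDA addnBA//; case/andP: hq.
by rewrite modnMDl modn_small//; lia.
Qed.

Lemma sub_left_block k : (k <= m)%N ->
  sub_left b k = (q %/ 2 ^ k * 2 ^ k)%N%:Z - q%:Z.
Proof.
move=> km; rewrite /sub_left /left_index sub_right_block//.
by have := ltn_block q k; lia.
Qed.

Lemma in_sub_block k p : (k <= m)%N ->
  in_sub b k (p%:Z - q%:Z) = (p %/ 2 ^ k == q %/ 2 ^ k)%N.
Proof.
move=> km; rewrite /in_sub sub_left_block// sub_right_block//.
have K0 := expn_gt0 2 k; rewrite eqn_leq -ltnS ltn_divLR// leq_divRL//.
by have := ltn_block q k; lia.
Qed.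

Lemma in_ext_block k p : (k < m)%N ->
  in_ext b k (p%:Z - q%:Z) = (p %/ 2 ^ k == sibling (q %/ 2 ^ k))%N.
Proof.
move=> km; rewrite /in_ext !in_sub_block ?(ltnW km)// !divn_expS.
apply/andP/eqP => [[/eqP e /eqP ne]|->]; first exact: sibling_half.
rewrite sibling_neq; move: (q %/ 2 ^ k)%N => c.
by rewrite /sibling; split=> //; case: ifP; lia.
Qed.

Lemma sumW_block k : (k <= m)%N ->
  sumW mu M h delta pmicro l z b k = block_sum W k (q %/ 2 ^ k).
Proof.
move=> km; apply: eq_bigr => t _; rewrite sub_left_block// /W.
by congr weight; lia.
Qed.

Lemma sumWext_block k : (k < m)%N ->
  sumWext mu M h delta pmicro l z b k = block_sum W k (sibling (q %/ 2 ^ k)).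
Proof.
move=> km; rewrite /sumWext sub_left_block// divn_expS.
set c := (q %/ 2 ^ k)%N; set c' := (c %/ 2)%N.
transitivity (\sum_(0 <= t < 2 ^ k.+1 |
    ((c' * 2 ^ k.+1 + t) %/ 2 ^ k == sibling c)%N) W (c' * 2 ^ k.+1 + t)%N).
  rewrite big_mkord; apply: eq_big => t => [|_].
    by rewrite -in_ext_block//; congr in_ext; lia.
  by rewrite /W; congr weight; lia.
have K0 := expn_gt0 2 k.
have hd : (c = c' * 2 + odd c)%N by rewrite /c'; lia.
have e1 t : (t < 2 ^ k)%N -> ((c' * 2 ^ k.+1 + t) %/ 2 ^ k = c' * 2)%N.
  by move=> tk; rewrite expnS mulnA divnMDl// divn_small// addn0.
have e2 t : (t < 2 ^ k)%N ->
    ((c' * 2 ^ k.+1 + (t + 2 ^ k)) %/ 2 ^ k = (c' * 2).+1)%N.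
  move=> tk; rewrite expnS mulnA divnMDl// -[X in (t + X)%N]mul1n.
  by rewrite divnDMl// divn_small// add0n addn1.
(* Cut the parent block in the middle: the filter keeps one half and drops the other. *)
rewrite (@big_cat_nat _ _ _ (2 ^ k))//= ?leq_exp2l//.
rewrite -[X in _ + \big[_/_]_(X <= _ < _ | _) _]add0n big_addn.
have -> : (2 ^ k.+1 - 2 ^ k = 2 ^ k)%N by rewrite expnS mul2n -addnn addnK.
rewrite /block_sum -(big_mkord xpredT (fun t => W (sibling c * 2 ^ k + t)%N)).
rewrite /sibling; case: (odd c) hd => /= hd.
  rewrite [X in _ + X]big_nat_cond [X in _ + X]big1 ?addr0; last first.
    by move=> t /andP[/andP[_ tk]]; rewrite e2// hd addn1 /= eqn_leq ltnn.
  rewrite big_nat_cond [RHS]big_nat_cond; apply: eq_big => t.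
    by rewrite andbT; case: ltnP => //= tk; rewrite e1// hd addn1 eqxx.
  by move=> _; rewrite hd addn1 /= expnS mulnA.
rewrite [X in X + _]big_nat_cond [X in X + _]big1 ?add0r; last first.
  by move=> t /andP[/andP[_ tk]]; rewrite e1// hd addn0 eqn_leq ltnn andbF.
rewrite big_nat_cond [RHS]big_nat_cond; apply: eq_big => t.
  by rewrite andbT; case: ltnP => //= tk; rewrite e2// hd addn0 eqxx.
move=> _; rewrite hd addn0 expnS mulnA; congr W.
by rewrite mulSnr -addnA [(t + _)%N]addnC.
Qed.

Lemma p_index_BP_block k p : (k <= m)%N ->
  p_index_BP mu M h delta pmicro l z b k (p%:Z - q%:Z) = dyadic_index W q k p.
Proof.
elim: k => [_|k IH km] /=; first by rewrite subr_eq0 eqz_nat.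
rewrite /alpha in_ext_block// in_sub_block ?(ltnW km)// IH ?(ltnW km)//.
by rewrite sumW_block ?(ltnW km)// sumWext_block.
Qed.

End IndexKernel.

(** * The joint density and its invariance *)

(** The least admissible exponent gives an element of the set that defines [micro], so the default
    of [xget] is not reached. *)
Lemma micro_pow2 (R : realType) (d : nat) (mu : 'cV[R]_d -> R) (M : 'M[R]_d)
    (h delta : R) (z : phase (R := R) (d := d)) :
    (exists n, micro_ok mu M h delta z (2 ^ n)%N) ->
  exists n, micro mu M h delta z = (2 ^ n)%N.
Proof.
move=> [n0 ok0].
have ex : exists n, `[< micro_ok mu M h delta z (2 ^ n)%N >].
  by exists n0; apply/asboolP.
have : is_micro mu M h delta z (micro mu M h delta z).
  apply: (@xgetPex _ 1%N [set l | is_micro mu M h delta z l]%classic).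
  case: (ex_minnP ex) => n /asboolP okn minn; exists (2 ^ n)%N.
  split=> [|//|k okk]; first by exists n.
  by rewrite leq_exp2l//; apply/minn/asboolP.
by case.
Qed.

(** Stated for any family and point that reproduce the path, so as to apply both to a tuple and to
    its image under [Psi]. *)
Lemma joint_path (R : realType) (d : nat) (mu : 'cV[R]_d -> R) (M : 'M[R]_d)
    (h delta : R) (pmicro : nat -> nat -> R) (mmax m q p : nat)
    (P : nat -> phase (R := R) (d := d)) (L : nat -> nat) (C : R)
    (l : int -> nat) (z : phase (R := R) (d := d)) s :
    (q < 2 ^ m)%N -> (p < 2 ^ m)%N ->
    (forall t : nat, l (t%:Z - q%:Z) = L t) ->
    (forall t : nat, evolve mu M h l (t%:Z - q%:Z) z = P t) ->
  let pp := path_plus mu M h delta pmicro P L in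
  let pm := path_minus mu M h delta pmicro P L in
  let A := path_weight (2 ^ m - 1)
    (fun t => expR (- hamiltonian mu M (P t))) pp pm in
    p_orbit mu M h delta pmicro mmax m (2 ^ m - 1 - q) s z
      = C * (\prod_(0 <= u < q) pm u * \prod_(q <= u < 2 ^ m - 1) pp u) ->
  expR (- hamiltonian mu M z)
    * p_orbit mu M h delta pmicro mmax m (2 ^ m - 1 - q) s z
    * p_index_BP mu M h delta pmicro l z (2 ^ m - 1 - q) m (p%:Z - q%:Z)
  = C * (A q * dyadic_index A q m p).
Proof.
move=> qm pm lL eP pp pn A ->.
have zP : z = P q by rewrite -eP subrr.
have -> : expR (- hamiltonian mu M z) *
    (C * (\prod_(0 <= u < q) pn u * \prod_(q <= u < 2 ^ m - 1) pp u)) = C * A q.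
  by rewrite /A /path_weight mulrCA zP.
(* Here the weights may divide by 0, but both sides vanish whatever the index kernel gives. *)
have [->|A0] := eqVneq (A q) 0; first by rewrite mulr0 !mul0r mulr0.
rewrite -mulrA; congr (_ * (_ * _)).
rewrite p_index_BP_block//.
have hpp t : p_plus mu M h delta pmicro l z (t%:Z - q%:Z) = pp t.
  by rewrite /p_plus eP lL.
have hpm t : p_minus mu M h delta pmicro l z (t%:Z - q%:Z) = pn t.
  by rewrite /p_minus (_ : t%:Z - q%:Z + 1 = t.+1%:Z - q%:Z) ?eP ?lL//; lia.
have hE t : expH mu M h l z (t%:Z - q%:Z) = expR (- hamiltonian mu M (P t)).
  by rewrite /expH eP.
have AE : A = path_weight (2 ^ m - 1)
    (fun t : nat => expH mu M h l z (t%:Z - q%:Z))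
    (fun t : nat => p_plus mu M h delta pmicro l z (t%:Z - q%:Z))
    (fun t : nat => p_minus mu M h delta pmicro l z (t%:Z - q%:Z)).
  by congr path_weight; apply/funext => t; rewrite ?hpp ?hpm ?hE.
have le1 t : (t < 2 ^ m)%N -> (t <= 2 ^ m - 1)%N by lia.
rewrite AE in A0.
(* On the orbit the weights are a nonzero multiple of [A], and the kernel ignores the factor. *)
rewrite (@dyadic_index_eq _ _ _ _ _ _ m (leqnn m) qm pm
  (fun t tm => weight_path_weight (le1 _ qm) A0 (le1 _ tm))).
rewrite dyadic_indexZ -?AE//; rewrite -AE in A0.
by rewrite mulf_neq0 ?invr_eq0// gt_eqF// expR_gt0.
Qed.

Theorem lemma6 (R : realType) (d : nat)
    (mu : 'cV[R]_d -> R) (M : 'M[R]_d) (h delta : R) (mmax : nat)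
    (pmicro : nat -> nat -> R)
    (mu_gt0 : forall x, 0 < mu x)
    (mu_C1 : C1 mu)
    (mu_int : lebesgue_integrable mu)
    (M_spd : sym_posdef M)
    (h_gt0 : 0 < h) (delta_gt0 : 0 < delta)
    (pmicro_pmf : forall n : nat, is_pmf_pos (pmicro (2 ^ n)%N))
    (micro_ex : forall z : 'cV[R]_d * 'cV[R]_d,
      exists n : nat, micro_ok mu M h delta z (2 ^ n)%N)
    (p_joint_BP : aug R d -> R)
    (p_joint_BP_def :
      proportional p_joint_BP (joint_BP mu M h delta pmicro mmax)) :
  p_joint_BP \o Psi mu M h = p_joint_BP.
Proof.
have draw_ge0 z l : 0 <= pmicro (micro mu M h delta z) l.
  have [n ->] := micro_pow2 (micro_ex z).
  by have [] := pmicro_pmf n.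
have [c c0 pE] := p_joint_BP_def; apply/funext => x /=; rewrite !pE.
congr (_ * _); case: x => z m b s i hb hs hp hi.
rewrite /joint_BP /=.
set l := aug_family _; set l' := aug_family _; set b' := Psi_b _.
set s' := Psi_ells _.
have b'E : b'%:Z = b%:Z - i by rewrite /b' Psi_bE.
have lE j : l j = nth 0%N s `|j - left_index m b|%N by [].
(* The shift of the family and that of its first index cancel. *)
have s'E : s' = s.
  rewrite /s' /Psi_ells /list_of /= -[RHS](mkseq_nth 0%N) hs.
  apply/eq_map => k; rewrite /Defs.shift -/l lE; congr nth; lia.
have l'E : l' = Defs.shift i l.
  apply/funext => j; rewrite /l' /aug_family /family_of /= -/s' -/b' s'E.
  by rewrite /Defs.shift lE; congr nth; rewrite /left_index b'E; lia.
rewrite l'E s'E {l' l'E s' s'E}.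
have hm := expn_gt0 2 m.
(* [q] is the position of the base, with [b] points to its right. *)
have [q bq qm] : exists2 q, b = (2 ^ m - 1 - q)%N & (q < 2 ^ m)%N.
  by exists (2 ^ m - 1 - b)%N; lia.
have leftE : left_index m b = - q%:Z by rewrite /left_index; lia.
have [p iE] : exists p : nat, i = p%:Z - q%:Z.
  by exists `|(i + q%:Z)%R|%N; move: (hi); rewrite leftE; lia.
have pm : (p < 2 ^ m)%N by move: (hi); rewrite leftE; lia.
have b'q : b' = (2 ^ m - 1 - p)%N by move: b'E; rewrite iE; lia.
rewrite leftE in lE; clearbody l b'; clear hi; subst b' b i.
(* All positions in [nat] are allowed: past the end of [s] the count is the default 0 and the path
   is stationary, so [P_step] holds everywhere. *)
pose P (t : nat) := evolve mu M h l (t%:Z - q%:Z) z.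
pose L (t : nat) := nth 0%N s t.
have lL t : l (t%:Z - q%:Z) = L t by rewrite lE /L opprK subrK.
have P_step t : P t.+1 = micro_steps mu M h (L t) (P t).
  by rewrite /P -lL -evolve_step; congr evolve; lia.
have sE : s = map L (iota 0 (2 ^ m - 1)) by rewrite -hs -/(mkseq _ _) mkseq_nth.
(* One constant [C] serves both base positions. *)
have [C CE] := p_orbit_path draw_ge0 m P_step mmax.
have := CE q qm; have := CE p pm; rewrite -sE => hCp hCq.
have lLp t : Defs.shift (p%:Z - q%:Z) l (t%:Z - p%:Z) = L t.
  by rewrite /Defs.shift -lL; congr l; lia.
have eP t : evolve mu M h (Defs.shift (p%:Z - q%:Z) l) (t%:Z - p%:Z) (P p) = P t.
  by rewrite evolve_shift; congr evolve; lia.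
have Pq : P q = z by rewrite /P subrr.
rewrite Pq in hCq; rewrite opprB.
apply: etrans (joint_path pm qm lLp eP hCp) _.
apply: etrans _ (esym (joint_path qm pm lL (fun=> erefl) hCq)).
(* At level [m] all positions of the orbit lie in block 0, so the balance applies to [p] and [q]. *)
congr (_ * _); apply: dyadic_balance => [t|]; last by rewrite !divn_small.
rewrite mulr_ge0 ?expR_ge0// mulr_ge0//; apply: prodr_ge0 => u _; exact: draw_ge0.
Qed.
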